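(* Let $\mathcal{A}=\langle A,R\rangle$ be an almost bounded structure, and let $\mathcal{A}^*$ be an ultrapower of $\mathcal{A}$ modulo some $\kappa$-regular ultrafilter, where $\kappa$ is an infinite cardinal. Then $\mathcal{A}^{\mathfrak{ue}}$ is (at least) $2^{2^{\aleph_0}}$-saturated, and $\mathcal{A}^*$ is (at least) $2^\kappa$-saturated.
   Context: All structures are of the form $\mathcal{A}=\langle A,R\rangle$ with a single binary relation $R\subseteq A\times A$. $\mathcal{A}$ is bounded if there is a finite number that bounds the in-degree and out-degree of every node of $\mathcal{A}$. $\mathcal{A}$ is almost bounded if, except for finitely many nodes with infinite degree (infinitely many $R$-successors or infinitely many $R$-predecessors), $\mathcal{A}$ is bounded; i.e. only finitely many nodes have infinite degree and there is a finite bound on the in- and out-degrees of all the other nodes. The ultrafilter extension of $\mathcal{A}$ is $\mathcal{A}^{\mathfrak{ue}}=\langle \mathrm{Uf}(A),R^{\mathfrak{ue}}\rangle$, where $\mathrm{Uf}(A)$ is the set of all ultrafilters over $A$ and $R^{\mathfrak{ue}}(u,v)$ holds iff $\{R[X]:X\in u\}\subseteq v$ (equivalently $\{\langle R\rangle(X):X\in v\}\subseteq u$), with $R[X]=\{s:(\exists w\in X)\,R(w,s)\}$ and $\langle R\rangle(X)=\{w:(\exists s\in X)\,R(w,s)\}$. A structure is $\mu$-saturated if it realizes every type (in finitely many variables, consistent with its elementary diagram) over each parameter set of cardinality $<\mu$. An ultrafilter $\mathcal{D}$ over an infinite set $I$ is $\kappa$-regular if there is $E\subseteq\mathcal{D}$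 with $|E|=\kappa$ such that each $i\in I$ belongs to only finitely many members of $E$. *)

(* Defs.v *)
From mathcomp Require Import all_boot.
From mathcomp Require Import boolp classical_sets functions cardinality filter.

Set Implicit Arguments.
Unset Strict Implicit.
Unset Printing Implicit Defensive.

Local Open Scope classical_set_scope.
Local Open Scope card_scope.

Record structure := Structure {
  carrier :> Type;
  edge : carrier -> carrier -> Prop
}.

Section Degrees.
Variable M : structure.

Definition successors (a : M) : set M := [set b | edge a b].
Definition predecessors (a : M) : set M := [set b | edge b a].

Definition infinite_degree (a : M) : Prop :=
  infinite_set (successors a) \/ infinite_set (predecessors a).

Definition almost_bounded : Prop :=
  finite_set [set a : M | infinite_degree a] /\
  exists k : nat, forall a : M, ~ infinite_degree a ->
    successors a #<= `I_k /\ predecessors a #<= `I_k.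

End Degrees.

(* Well-scoped de Bruijn syntax: [formula C n] is the set of first-order
   formulas with equality, one binary relation symbol and constants from [C],
   whose free variables are among the n variables 'I_n; sentences are the
   elements of [formula C 0]. The quantifier binds variable [ord0] and shifts
   the others. The remaining connectives are the usual classical
   abbreviations. *)
Inductive term (C : Type) (n : nat) : Type :=
| Var of 'I_n
| Cst of C.

Inductive formula (C : Type) : nat -> Type :=
| Bot n : formula C n
| Eq n : term C n -> term C n -> formula C n
| Rel n : term C n -> term C n -> formula C n
| Imp n : formula C n -> formula C n -> formula C n
| All n : formula C n.+1 -> formula C n.

Section Satisfaction.
Variables (C : Type) (M : structure).

Definition extend n (a : M) (v : 'I_n -> M) : 'I_n.+1 -> M :=
  fun i => if unlift ord0 i is Some j then v j else a.

Definition eval (c : C -> M) n (v : 'I_n -> M) (t : term C n) : M :=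
  match t with Var i => v i | Cst x => c x end.

Fixpoint sat (c : C -> M) n (phi : formula C n) : ('I_n -> M) -> Prop :=
  match phi in formula _ n return ('I_n -> M) -> Prop with
  | Bot _ => fun _ => False
  | Eq _ s t => fun v => eval c v s = eval c v t
  | Rel _ s t => fun v => edge (eval c v s) (eval c v t)
  | Imp _ f g => fun v => sat c f v -> sat c g v
  | All _ f => fun v => forall a : M, sat c f (extend a v)
  end.

Definition realizes (c : C -> M) n (p : set (formula C n)) (v : 'I_n -> M) :
    Prop :=
  forall phi, p phi -> sat c phi v.

End Satisfaction.

Section Saturation.
Variable M : structure.

Definition no_var (N : structure) : 'I_0 -> N :=
  fun i => False_rect N (notF (ltn_ord i)).

Definition elementary_diagram : set (formula M 0) :=
  [set phi | sat (fun a : M => a) phi (@no_var M)].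

(* The diagram together with [p], read in fresh constants for its n
   variables, has a model [N]; [j] interprets the constants naming the
   elements of [M]. *)
Definition consistent_type (B : set M) n (p : set (formula B n)) : Prop :=
  exists (N : structure) (j : M -> N),
    realizes j elementary_diagram (@no_var N) /\
    exists v : 'I_n -> N, realizes (fun b : B => j (val b)) p v.

Definition card_lt T U (X : set T) (Y : set U) : Prop :=
  X #<= Y /\ ~ (Y #<= X).

(* The cardinal mu is represented by a type of that cardinality. *)
Definition saturated (mu : Type) : Prop :=
  forall B : set M, card_lt B [set: mu] ->
  forall (n : nat) (p : set (formula B n)), consistent_type p ->
  exists v : 'I_n -> M, realizes (fun b : B => val b) p v.

End Saturation.

Section UltrafilterExtension.
Variable M : structure.

Definition Uf (T : Type) : Type := {u : set_system T | UltraFilter u}.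

Definition rel_image (X : set M) : set M :=
  [set s | exists2 w, X w & edge w s].

Definition ultrafilter_extension : structure :=
  @Structure (Uf M)
    (fun u v => [set rel_image X | X in sval u] `<=` sval v).

End UltrafilterExtension.

Section Ultrapower.
Variables (M : structure) (I : Type) (D : set_system I).

Definition ultra_class (f : I -> M) : set (I -> M) :=
  [set g | D [set i | f i = g i]].

Definition ultrapower_carrier : Type :=
  {c : set (I -> M) | exists f, c = ultra_class f}.

Definition ultrapower : structure :=
  @Structure ultrapower_carrier
    (fun c d => exists f g, [/\ sval c f, sval d g &
                                D [set i | edge (f i) (g i)]]).

End Ultrapower.

(* The cardinal kappa is represented by a type [K] of that cardinality. *)
Definition regular_ultrafilter (K I : Type) (D : set_system I) : Prop :=
  [/\ infinite_set [set: I], UltraFilter D &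
      exists E : set (set I),
        [/\ E `<=` D, E #= [set: K] &
            forall i : I, finite_set [set X | E X /\ X i]]].

(* Main.v *)
Require Import Defs.
From mathcomp Require Import all_boot.
From mathcomp Require Import boolp classical_sets functions cardinality filter.

(** Delete the finitely many nodes of infinite degree, and remember the edges
    to and from them as colours of the remaining nodes. What is left is a graph
    of bounded degree, whose components are countable. A structure M of this
    kind has a very simple model theory. An elementary extension N of M inherits
    the degree bound, and since the finitely many neighbours of a node of M can
    be listed by a formula, N arises from M by adding whole components.
    Moreover N has many automorphisms: two isomorphic components can be
    exchanged while everything else is fixed ([swap_automorphism]).

    This reduces saturation to counting components. Let a type over B be
    realized in N by a tuple. If a coordinate lies in a new component, then
    every finite part of this component, being described by a formula that
    avoids any given finite subset of M, occurs infinitely often in M. Suppose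
    that a component all of whose finite parts occur infinitely often in M
    occurs in M as a whole, in mu disjoint copies. If B has fewer than mu
    elements, then one copy misses B, and exchanging it with the new component
    moves the coordinate into M and fixes B. After finitely many exchanges the
    whole tuple is in M, and it realizes the type there because N is an
    elementary extension of M ([saturated_of_many_copies]).

    It remains to find the copies. Both the ultrapower and the ultrafilter
    extension consist of limits of functions with values in A, the latter as
    push-forwards of ultrafilters ([limit_map]). An approximation in the
    extension therefore comes from approximations in A ([approx_of_limit]), and
    in A one chooses pairwise disjoint approximations H 0, H 1, H 2, ... of
    increasing precision ([disjoint_sequence]). Limits of these along indices
    that tend to infinity are copies of the component ([approx_limit]), and
    limits along different indices are disjoint. In the ultrapower the indices
    are infinite elements of the ultrapower of the natural numbers, of which a
    kappa-regular ultrafilter provides 2^kappa ([regular_many_naturals]). In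
    the ultrafilter extension they are nonprincipal ultrafilters on the natural
    numbers, of which there are 2^(2^aleph_0) ([many_ultrafilters]).

    In the ultrafilter extension limits do not determine the behaviour of
    functions almost everywhere. They do so for functions which move nodes by a
    bounded distance, because every ultrafilter contains a set whose points are
    far from each other ([ultra_sparse], [push_faithful]). *)

Set Implicit Arguments.
Unset Strict Implicit.
Unset Printing Implicit Defensive.

Local Open Scope classical_set_scope.
Local Open Scope card_scope.

(** * Substitution, automorphisms and definability *)

Section Syntax.
Variables C D : Type.

Definition shift n (t : term D n) : term D n.+1 :=
  match t with Var i => Var D (lift ord0 i) | Cst d => Cst n.+1 d end.

Definition up n l (sigma : 'I_n -> term D l) (i : 'I_n.+1) : term D l.+1 :=
  if unlift ord0 i is Some j then shift (sigma j) else Var D ord0.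

Definition tsubst (gamma : C -> D) n l (sigma : 'I_n -> term D l)
    (t : term C n) : term D l :=
  match t with Var i => sigma i | Cst c => Cst l (gamma c) end.

Fixpoint subst (gamma : C -> D) n (phi : formula C n) :
    forall l, ('I_n -> term D l) -> formula D l :=
  match phi in formula _ n return forall l, ('I_n -> term D l) -> formula D l
  with
  | Bot _ => fun l _ => Bot D l
  | Eq _ s t => fun l sigma =>
      Eq (tsubst gamma sigma s) (tsubst gamma sigma t)
  | Rel _ s t => fun l sigma =>
      Rel (tsubst gamma sigma s) (tsubst gamma sigma t)
  | Imp _ f g => fun l sigma => Imp (subst gamma f sigma) (subst gamma g sigma)
  | All _ f => fun l sigma => All (subst gamma f (up sigma))
  end.

End Syntax.

Lemma extend0 (M : structure) n (a : M) (v : 'I_n -> M) :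
  extend a v ord0 = a.
Proof. by rewrite /extend unlift_none. Qed.

Lemma extend_lift (M : structure) n (a : M) (v : 'I_n -> M) i :
  extend a v (lift ord0 i) = v i.
Proof. by rewrite /extend liftK. Qed.

Lemma eval_shift (D : Type) (M : structure) (d : D -> M) n (t : term D n) a v :
  eval d (extend a v) (shift t) = eval d v t.
Proof. by case: t => [i|x] //=; rewrite extend_lift. Qed.

(** Substitution turns the parameters of a formula into constants, so that
    preservation of the sentences of a diagram gives preservation of all
    formulas with parameters. *)
Lemma sat_subst (C D : Type) (M : structure) (gamma : C -> D) (d : D -> M) n
    (phi : formula C n) l (sigma : 'I_n -> term D l) (v : 'I_l -> M) :
  sat d (subst gamma phi sigma) v <->
  sat (d \o gamma) phi (fun i => eval d v (sigma i)).
Proof.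
elim: phi l sigma v => [k|k s t|k s t|k f IHf g IHg|k f IHf] l sigma v //=.
- by case: s t => [i|x] [j|y].
- by case: s t => [i|x] [j|y].
- by rewrite IHf IHg.
- have E a : (fun i => eval d (extend a v) (up sigma i)) =
             extend a (fun i => eval d v (sigma i)).
    apply: funext => i; rewrite /up.
    case: unliftP => [j ->|->] /=; first by rewrite extend_lift eval_shift.
    by rewrite !extend0.
  by split=> H a; have := H a; rewrite IHf E.
Qed.

Lemma extend_comp (N N' : structure) (tau : N -> N') n a (v : 'I_n -> N) :
  extend (tau a) (tau \o v) = tau \o extend a v.
Proof.
by apply: funext => i; rewrite /extend /=; case: unliftP.
Qed.

Lemma eval_comp (C : Type) (N N' : structure) (tau : N -> N') (c : C -> N) n
    (v : 'I_n -> N) (t : term C n) :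
  eval (tau \o c) (tau \o v) t = tau (eval c v t).
Proof. by case: t. Qed.

Definition automorphism (N : structure) (tau : N -> N) : Prop :=
  bijective tau /\ forall x y, edge (tau x) (tau y) <-> edge x y.

Lemma sat_automorphism (C : Type) (N : structure) (tau : N -> N) :
  automorphism tau -> forall (c : C -> N) n (phi : formula C n) (v : 'I_n -> N),
  sat (tau \o c) phi (tau \o v) <-> sat c phi v.
Proof.
move=> [[tau' tauK tau'K] tauE] c n phi.
elim: phi => [k|k s t|k s t|k f IHf g IHg|k f IHf] v //=.
- by rewrite !eval_comp; split=> [/(can_inj tauK)|->].
- by rewrite !eval_comp.
- by rewrite IHf IHg.
- split=> H a; first by apply/IHf; rewrite -extend_comp; apply: H.
  by rewrite -[a]tau'K extend_comp; apply/IHf.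
Qed.

Lemma no_var_unique (M : structure) (v : 'I_0 -> M) : v = @no_var M.
Proof. by apply: funext => -[]. Qed.

Fixpoint closure (C : Type) n : formula C n -> formula C 0 :=
  match n with
  | 0 => id
  | _.+1 => fun phi => closure (All phi)
  end.

Lemma sat_closure (C : Type) (M : structure) (c : C -> M) n
    (phi : formula C n) :
  sat c (closure phi) (@no_var M) <-> forall v, sat c phi v.
Proof.
elim: n phi => [|n IH] phi /=.
  by split=> [H v|]; [rewrite (no_var_unique v)|apply].
rewrite IH /=; split=> H v; last by move=> a; apply: H.
have -> : v = extend (v ord0) (fun i => v (lift ord0 i)).
  apply: funext => i.
  by case: (unliftP ord0 i) => [j ->|->]; rewrite ?extend_lift ?extend0.
exact: H.
Qed.

Section Definability.
Variable C : Type.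

(** Formulas are never written out: a property is given by its meaning in all
    structures at once, and the closure lemmas that follow produce the
    formula. *)
Definition definable n
    (P : forall S : structure, (C -> S) -> ('I_n -> S) -> Prop) : Prop :=
  exists phi : formula C n, forall S c v, sat c phi v <-> P S c v.

Lemma eq_definable n P Q : (forall S c v, P S c v <-> Q S c v) ->
  @definable n P -> definable Q.
Proof. by move=> PQ [phi phiP]; exists phi => S c v; rewrite phiP PQ. Qed.

Lemma definable_eq n (s t : term C n) :
  definable (fun S c v => eval c v s = eval c v t).
Proof. by exists (Eq s t). Qed.

Lemma definable_edge n (s t : term C n) :
  definable (fun S c v => edge (eval c v s) (eval c v t)).
Proof. by exists (Rel s t). Qed.

Lemma definable_imp n P Q : @definable n P -> definable Q ->
  definable (fun S c v => P S c v -> Q S c v).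
Proof.
by move=> [f fP] [g gQ]; exists (Imp f g) => S c v /=; rewrite fP gQ.
Qed.

(** A proposition that does not involve the valuation can be hard-wired into
    the formula. In this way a formula about one structure records the atomic
    facts that hold in another. *)
Lemma definable_const n (Q : Prop) : @definable n (fun _ _ _ => Q).
Proof.
have [q|nq] := pselect Q; last by exists (Bot C n) => S c v /=; split.
by exists (Imp (Bot C n) (Bot C n)) => S c v /=; split.
Qed.

Lemma definable_not n P : @definable n P ->
  definable (fun S c v => ~ P S c v).
Proof. by move=> dP; apply: definable_imp => //; apply: definable_const. Qed.

Lemma definable_and n P Q : @definable n P -> definable Q ->
  definable (fun S c v => P S c v /\ Q S c v).
Proof.
move=> dP dQ.
apply: eq_definable (definable_not (definable_imp dP (definable_not dQ))).
by move=> S c v; split=> [H|[p q] /(_ p)//]; split; apply: contrapT => n1;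
  apply: H => p // q; apply: n1.
Qed.

Lemma definable_or n P Q : @definable n P -> definable Q ->
  definable (fun S c v => P S c v \/ Q S c v).
Proof.
move=> dP dQ; apply: eq_definable (definable_imp (definable_not dP) dQ).
move=> S c v; split=> [H|[//|//]].
by case: (pselect (P S c v)) => [|/H]; [left|right].
Qed.

Lemma definable_iff n P Q : @definable n P -> definable Q ->
  definable (fun S c v => P S c v <-> Q S c v).
Proof. by move=> dP dQ; apply: definable_and; apply: definable_imp. Qed.

Lemma definable_forall_fin n (T : finType) P :
  (forall t : T, @definable n (P t)) ->
  definable (fun S c v => forall t, P t S c v).
Proof.
move=> dP.
have aux (s : seq T) : definable (fun S c v => forall t, t \in s -> P t S c v).
  elim: s => [|t s IH].
    by apply: eq_definable (@definable_const n True) => S c v; split.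
  apply: eq_definable (definable_and (dP t) IH) => S c v; split.
    by move=> [H1 H2] u; rewrite inE => /predU1P[->//|/H2].
  by move=> H; split=> [|u us]; apply: H; rewrite inE ?eqxx ?us ?orbT.
apply: eq_definable (aux (enum T)) => S c v; split=> H t //.
by apply: H; rewrite mem_enum.
Qed.

Lemma definable_exists_fin n (T : finType) P :
  (forall t : T, @definable n (P t)) ->
  definable (fun S c v => exists t, P t S c v).
Proof.
move=> dP; apply: eq_definable (definable_not (definable_forall_fin
  (fun t => definable_not (dP t)))) => S c v.
split=> [H|[t tP] /(_ t)//].
by apply: contrapT => none; apply: H => t tP; apply: none; exists t.
Qed.

Lemma definable_forall n
    (P : forall S : structure, (C -> S) -> S -> ('I_n -> S) -> Prop) :
  definable (fun S c v => P S c (v ord0) (fun i => v (lift ord0 i))) ->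
  definable (fun S c v => forall y, P S c y v).
Proof.
move=> [phi phiP]; exists (All phi) => S c v /=.
have E y : (fun i => extend y v (lift ord0 i)) = v.
  by apply: funext => i; rewrite extend_lift.
by split=> H y; have := H y; rewrite phiP extend0 E.
Qed.

End Definability.

(** * Elementary extensions *)

Definition elementary (M N : structure) (j : M -> N) : Prop :=
  realizes j (@elementary_diagram M) (@no_var N).

Section Elementary.
Variables (M N : structure) (j : M -> N).
Hypothesis jE : elementary j.

Lemma elementary_sentence (phi : formula M 0) :
  sat id phi (@no_var M) <-> sat j phi (@no_var N).
Proof.
split=> [Mphi|jphi]; first exact: (jE Mphi).
case: (pselect (sat id phi (@no_var M))) => // Nphi.
by case: (jE (phi := Imp phi (Bot M 0)) Nphi jphi).
Qed.

Lemma elementary_sat (C : Type) (c : C -> M) n (phi : formula C n)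
    (v : 'I_n -> M) :
  sat c phi v <-> sat (j \o c) phi (j \o v).
Proof.
have := elementary_sentence (subst c phi (fun i => Cst 0 (v i))).
by rewrite !sat_subst.
Qed.

Lemma elementary_exists n (phi : formula M n) :
  (exists v, sat j phi v) -> exists v, sat id phi v.
Proof.
case=> v vphi; apply: contrapT => none.
have /elementary_sentence/sat_closure/(_ v) :
    sat id (closure (Imp phi (Bot M n))) (@no_var M).
  by apply/sat_closure => w wphi; apply: none; exists w.
exact.
Qed.

(** Existential statements go down from an elementary extension, because their
    negations are universal sentences with parameters, which go up. *)
Lemma elementary_definable n P : @definable M n P ->
  (exists v, P N j v) -> exists v, P M id v.
Proof.
case=> phi phiP [v /phiP vphi].
by case: (elementary_exists (ex_intro _ v vphi)) => w /phiP; exists w.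
Qed.

End Elementary.

(** * Cardinality *)

Lemma card_le_inj T U (A : set T) (B : set U) (f : T -> U) :
  (forall x, A x -> B (f x)) ->
  (forall x y, A x -> A y -> f x = f y -> x = y) -> A #<= B.
Proof.
move=> AB fI.
have /card_eqPle[_ AfA] : f @` A #= A.
  by apply: inj_card_eq => x y; rewrite !inE; apply: fI.
by apply: card_le_trans AfA _; apply: subset_card_le => _ [x /AB ? <-].
Qed.

Lemma card_le_exists_inj T U (A : set T) (B : set U) (u0 : U) : A #<= B ->
  exists f : T -> U, (forall x, A x -> B (f x)) /\
    (forall x y, A x -> A y -> f x = f y -> x = y).
Proof.
elim/Ppointed: U => U in B u0 *; first by case: (no u0).
move=> /pcard_leP/injfunPex[f fAB fI]; exists f; split=> // x y Ax Ay.
by apply: fI; rewrite inE.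
Qed.

(** Hilbert's hotel: along a sequence [iota] outside [X] the guests move to
    rooms of odd number, and the finitely many elements of [X] take rooms of
    even number. *)
Lemma card_le_finite_removed (U : Type) (X : set U) :
  infinite_set [set: U] -> finite_set X -> [set: U] #<= ~` X.
Proof.
move=> Uinf Xfin.
have Cinf : infinite_set (~` X).
  by have := infinite_setD Uinf Xfin; rewrite setTD.
have /infinite_setN0[u0 _] := Uinf.
have [iota [iotaT iotaTI]] :=
  card_le_exists_inj u0 (proj1 (infiniteP _) Cinf).
have iotaX n : ~ X (iota n) by apply: iotaT.
have iotaI : injective iota by move=> x y; apply: iotaTI.
have [kap kapI] := countable_injP _ (finite_set_countable Xfin).
have cases x : [\/ X x, exists n, x = iota n | ~ X x /\ forall n, x <> iota n].
  case: (pselect (X x)) => [|NX]; first by constructor 1.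
  case: (pselect (exists n, x = iota n)) => [|Ni]; first by constructor 2.
  by constructor 3; split=> // n xn; apply: Ni; exists n.
have /choice[f fP] : forall x, exists y, [/\ X x -> y = iota (kap x).*2,
    forall n, x = iota n -> y = iota n.*2.+1 &
    ~ X x -> (forall n, x <> iota n) -> y = x].
  move=> x; case: (cases x) => [Xx|[n ->]|[NX Ni]].
  - exists (iota (kap x).*2); split=> // n xn.
    by case: (iotaX n) => //; rewrite -xn.
  - exists (iota n.*2.+1); split=> [/iotaX//|k /iotaI ->//|_ /(_ n)//].
  - by exists x; split=> // n /Ni.
have image_cases x : [\/ X x /\ f x = iota (kap x).*2,
    exists n, x = iota n /\ f x = iota n.*2.+1 |
    [/\ ~ X x, forall n, x <> iota n & f x = x]].
  case: (fP x) => fX fi fO; case: (cases x) => [Xx|[n xn]|[NX Ni]].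
  - by constructor 1; split=> //; apply: fX.
  - by constructor 2; exists n; split=> //; apply: fi.
  - by constructor 3; split=> //; apply: fO.
apply: (card_le_inj (f := f)) => [x _|x y _ _].
  by case: (image_cases x) => [[_ ->]|[n [_ ->]]|[NX _ ->]] //; apply: iotaX.
case: (image_cases x) => [[Xx ->]|[n [-> ->]]|[NX Ni ->]];
  case: (image_cases y) => [[Xy ->]|[k [-> ->]]|[NY Nk ->]] // e.
- by have /double_inj := iotaI _ _ e; apply: kapI; rewrite inE.
- by have /(congr1 odd) := iotaI _ _ e; rewrite /= !odd_double.
- by case: (Nk (kap x).*2).
- by have /(congr1 odd) := iotaI _ _ e; rewrite /= !odd_double.
- by have [/double_inj ->] := iotaI _ _ e.
- by case: (Nk n.*2.+1).
- by case: (Ni (kap y).*2).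
- by case: (Ni k.*2.+1).
Qed.

Lemma not_card_le_setU (U T : Type) (B F : set T) :
  infinite_set [set: U] -> finite_set F ->
  ~ ([set: U] #<= B) -> ~ ([set: U] #<= B `|` F).
Proof.
move=> Uinf Ffin UB UBF; apply: UB.
have /infinite_setN0[u0 _] := Uinf.
have /set0P[t0 _] : B `|` F != set0.
  apply/eqP => E; move: UBF; rewrite E => /card_le0P E'.
  by have : [set: U] u0 by []; rewrite E'.
have [f [fBF fI]] := card_le_exists_inj t0 UBF.
have Xfin : finite_set (f @^-1` F).
  apply: card_le_finite Ffin; apply: card_ge_preimage => x y _ _.
  exact: fI.
apply: card_le_trans (card_le_finite_removed Uinf Xfin) _.
apply: (card_le_inj (f := f)) => [x /= NF|x y _ _]; last exact: fI.
by case: (fBF x I).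
Qed.

Lemma finite_setP_range T (A : set T) :
  finite_set A -> exists n (f : 'I_n -> T), A = range f.
Proof.
elim/Ppointed: T => T in A *; first
  by exists 0, (fun i : 'I_0 => False_rect T (notF (ltn_ord i)));
     apply/seteqP; split=> x; case: (no x).
move=> [n An].
have /card_esym : A #= [set: 'I_n] := card_eq_trans An card_II.
move=> /card_set_bijP[f [fA _ fS]].
exists n, f; apply/seteqP.
by split=> [x /fS[i _ <-]|_ [i _ <-]]; [exists i|apply: fA].
Qed.

(** * Components and their enumerations *)

Definition adj (S : structure) (x y : S) : Prop := edge x y \/ edge y x.

Lemma adjC (S : structure) (x y : S) : adj x y -> adj y x.
Proof. by case; [right|left]. Qed.

(** The tuple [f] names the nodes of infinite degree. Seen from the other
    nodes, the edges to and from the entries of [f] are finitely many colours,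
    and the remaining edges form a graph of bounded degree. *)
Definition special m (S : structure) (f : 'I_m -> S) (x : S) : Prop :=
  exists a, x = f a.

(** The bound is expressed by tuples of a fixed length, hence by a first-order
    formula, so that elementary extensions inherit it. *)
Definition at_most K (S : structure) (P : set S) : Prop :=
  forall y : 'I_K.+1 -> S, injective y -> ~ forall i, P (y i).

(** Either the set is exhausted, or an injective tuple in it can be
    lengthened, which stops at length K. *)
Lemma at_most_cover K (S : structure) (P : set S) (x0 : S) : at_most K P ->
  exists e : 'I_K -> S, (forall i, e i = x0 \/ P (e i)) /\
    forall y, P y -> exists i, y = e i.
Proof.
move=> PK; apply: contrapT => nocover.
suff long n : n <= K.+1 ->
    exists y : 'I_n -> S, injective y /\ forall i, P (y i).
  by have [y [yI /(PK y yI)]] := long _ (leqnn _).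
elim: n => [_|n IH nK]; first by exists (@no_var S); split=> -[].
have [y [yI yP]] := IH (ltnW nK).
have [z [Pz zy]] : exists z, P z /\ forall i, z <> y i.
  apply: contrapT => none; apply: nocover.
  exists (fun i : 'I_K =>
    if insub (val i) : option 'I_n is Some k then y k else x0).
  split=> [i|z Pz]; first by case: insubP => [k _ _|_]; [right|left].
  apply: contrapT => zy; apply: none; exists z; split=> // k zk; apply: zy.
  by exists (widen_ord (nK : n <= K) k); rewrite /= valK.
exists (extend z y); split=> [i k|i].
  case: (unliftP ord0 i) => [i' ->|->]; case: (unliftP ord0 k) => [k' ->|->];
    rewrite ?extend_lift ?extend0 //.
  - by move=> /yI ->.
  - by move=> /esym/zy.
  - by move=> /zy.
by case: (unliftP ord0 i) => [i' ->|->]; rewrite ?extend_lift ?extend0.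
Qed.

Section Charts.
Variables (m K : nat).
Hypothesis K_gt0 : 0 < K.

Section Like.
Variables (S T : structure) (f : 'I_m -> S) (f' : 'I_m -> T).

Definition same_atoms (x y : S) (x' y' : T) : Prop :=
  [/\ x = y <-> x' = y', edge x y <-> edge x' y',
      forall a, edge x (f a) <-> edge x' (f' a) &
      forall a, edge (f a) x <-> edge (f' a) x'].

(** Components are enumerated in heap order: the K children of number p have
    the numbers p * K + q + 1 with q < K. Hence the numbers up to [r] form a
    finite part of the component which a single formula describes, and the
    last clause makes a sequence that satisfies it for all [r] closed under
    adjacency outside the special nodes. *)
Definition approx r (e : nat -> S) (h : nat -> T) : Prop :=
  [/\ forall s, s <= r -> ~ special f' (h s),
      forall s t, s <= r -> t <= r -> same_atoms (e s) (e t) (h s) (h t) &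
      forall p, p.+1 * K <= r -> forall y, ~ special f' y -> adj (h p) y ->
        exists2 q, q < K & y = h (p * K + q).+1].

Definition copy (e : nat -> S) (h : nat -> T) : Prop :=
  forall r, approx r e h.

End Like.

Lemma child_le p q : q < K -> (p * K + q).+1 <= p.+1 * K.
Proof. by move=> qK; rewrite mulSn addnC -addSn leq_add2r. Qed.

Lemma parent_le p : p <= p.+1 * K.
Proof. by apply: leq_trans (leqnSn p) _; rewrite leq_pmulr. Qed.

Lemma approx_le (S T : structure) (f : 'I_m -> S) (f' : 'I_m -> T) r r' e h :
  r' <= r -> approx f f' r e h -> approx f f' r' e h.
Proof.
move=> rr [h1 h2 h3]; split=> [s sr|s t sr tr|p pr].
- exact: h1 (leq_trans sr rr).
- by apply: h2; [exact: leq_trans sr rr|exact: leq_trans tr rr].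
- exact: h3 (leq_trans pr rr).
Qed.

Lemma same_atoms_trans (S T U : structure) (f : 'I_m -> S) (f' : 'I_m -> T)
    (f'' : 'I_m -> U) x y x' y' x'' y'' :
  same_atoms f f' x y x' y' -> same_atoms f' f'' x' y' x'' y'' ->
  same_atoms f f'' x y x'' y''.
Proof.
move=> [a1 a2 a3 a4] [b1 b2 b3 b4]; split=> [||a|a].
- exact: iff_trans a1 b1.
- exact: iff_trans a2 b2.
- exact: iff_trans (a3 a) (b3 a).
- exact: iff_trans (a4 a) (b4 a).
Qed.

Lemma approx_trans (S T U : structure) (f : 'I_m -> S) (f' : 'I_m -> T)
    (f'' : 'I_m -> U) r e h k :
  approx f f' r e h -> approx f' f'' r h k -> approx f f'' r e k.
Proof.
move=> [_ h2 _] [k1 k2 k3]; split=> // s t sr tr.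
exact: same_atoms_trans (h2 _ _ sr tr) (k2 _ _ sr tr).
Qed.

Section SwapAutomorphism.
Variables (N : structure) (f : 'I_m -> N) (e g : nat -> N).
Hypothesis ee : copy f f e e.
Hypothesis eg : copy f f e g.
Hypothesis disj : forall s t, e s <> g t.

Let nonspecial_e s : ~ special f (e s).
Proof. by have [H _ _] := ee s; apply: H. Qed.

Let nonspecial_g s : ~ special f (g s).
Proof. by have [H _ _] := eg s; apply: H. Qed.

Let atoms_eg s t : same_atoms f f (e s) (e t) (g s) (g t).
Proof.
by have [_ H _] := eg (maxn s t); apply: H; rewrite leq_max leqnn ?orbT.
Qed.

Let closed_e s y : ~ special f y -> adj (e s) y -> exists t, y = e t.
Proof.
have [_ _ H] := ee (s.+1 * K) => Ny ay.
by have [q _ ->] := H _ (leqnn _) _ Ny ay; exists (s * K + q).+1.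
Qed.

Let closed_g s y : ~ special f y -> adj (g s) y -> exists t, y = g t.
Proof.
have [_ _ H] := eg (s.+1 * K) => Ny ay.
by have [q _ ->] := H _ (leqnn _) _ Ny ay; exists (s * K + q).+1.
Qed.

(** The ranges of [e] and [g] have no edges to anything but themselves and the
    special nodes, and the latter edges match. So exchanging the two ranges
    and fixing all other nodes respects edges. *)
Lemma swap_automorphism : exists tau : N -> N,
  [/\ automorphism tau, forall s, tau (e s) = g s &
      forall x, (forall s, x <> e s) -> (forall s, x <> g s) -> tau x = x].
Proof.
have eq_eg s t : e s = e t <-> g s = g t by have [] := atoms_eg s t.
have cases x : [\/ exists s, x = e s, exists s, x = g s |
    (forall s, x <> e s) /\ (forall s, x <> g s)].
  case: (pselect (exists s, x = e s)) => [|Ne]; first by constructor 1.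
  case: (pselect (exists s, x = g s)) => [|Ng]; first by constructor 2.
  by constructor 3; split=> s xs; [apply: Ne|apply: Ng]; exists s.
have /choice[tau tauP] : forall x, exists y, [/\ forall s, x = e s -> y = g s,
    forall s, x = g s -> y = e s &
    (forall s, x <> e s) -> (forall s, x <> g s) -> y = x].
  move=> x; case: (cases x) => [[s ->]|[s ->]|[Ne Ng]].
  - by exists (g s); split=> [t /eq_eg//|t /disj//|/(_ s)//].
  - by exists (e s); split=> [t /esym/disj//|t /eq_eg//|_ /(_ s)//].
  - by exists x; split=> // s xs; [case: (Ne s)|case: (Ng s)].
have taue s : tau (e s) = g s by case: (tauP (e s)) => H _ _; apply: H.
have taug s : tau (g s) = e s by case: (tauP (g s)) => _ H _; apply: H.
have tauo x : (forall s, x <> e s) -> (forall s, x <> g s) -> tau x = x.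
  by case: (tauP x).
have tauK : involutive tau.
  move=> x; case: (cases x) => [[s ->]|[s ->]|[Ne Ng]].
  - by rewrite taue taug.
  - by rewrite taug taue.
  - by rewrite !tauo.
exists tau; split=> //; split; first exact: inv_bij.
suff mono x y : edge x y -> edge (tau x) (tau y).
  by move=> x y; split=> [/mono|/mono//]; rewrite !tauK.
move=> xy; case: (cases x) => [[s xs]|[s xs]|[Ne Ng]];
    case: (cases y) => [[t yt]|[t yt]|[Me Mg]]; subst; rewrite ?taue ?taug.
- by have [_ /iffLR H _ _] := atoms_eg s t; apply: H.
- by have [u /esym/disj] := closed_e (@nonspecial_g t) (or_introl xy).
- rewrite (tauo _ Me Mg); case: (pselect (special f y)) => [[a ya]|Ny].
    by subst y; have [_ _ H _] := atoms_eg s s; apply/H.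
  by have [u /Me] := closed_e Ny (or_introl xy).
- by have [u /disj] := closed_g (@nonspecial_e t) (or_introl xy).
- by have [_ /iffRL H _ _] := atoms_eg s t; apply: H.
- rewrite (tauo _ Me Mg); case: (pselect (special f y)) => [[a ya]|Ny].
    by subst y; have [_ _ H _] := atoms_eg s s; apply/H.
  by have [u /Mg] := closed_g Ny (or_introl xy).
- rewrite (tauo _ Ne Ng); case: (pselect (special f x)) => [[a xa]|Nx].
    by subst x; have [_ _ _ H] := atoms_eg t t; apply/H.
  by have [u /Ne] := closed_e Nx (or_intror xy).
- rewrite (tauo _ Ne Ng); case: (pselect (special f x)) => [[a xa]|Nx].
    by subst x; have [_ _ _ H] := atoms_eg t t; apply/H.
  by have [u /Ng] := closed_g Nx (or_intror xy).
- by rewrite !tauo.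
Qed.

End SwapAutomorphism.

(** The number n + 1 has parent n %/ K. A node with fewer than K neighbours
    fills its spare children with itself, hence the first alternative. *)
Definition heap (S : structure) (e : nat -> S) : Prop :=
  forall n, e n.+1 = e (n %/ K) \/ adj (e (n %/ K)) (e n.+1).

Definition degree_le (S : structure) (f : 'I_m -> S) : Prop :=
  forall x, ~ special f x -> at_most K (adj x).

Lemma exists_chart (S : structure) (f : 'I_m -> S) (c : S) :
  degree_le f -> ~ special f c ->
  exists e : nat -> S, [/\ e 0 = c, heap e & copy f f e e].
Proof.
move=> deg Nc.
have /choice[nbr nbrP] : forall x, exists b : 'I_K -> S, ~ special f x ->
    (forall i, b i = x \/ adj x (b i) /\ ~ special f (b i)) /\
    forall y, adj x y -> ~ special f y -> exists i, y = b i.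
  move=> x; case: (pselect (special f x)) => [|Nx]; first by exists (fun=> x).
  have [|b [b1 b2]] :=
      @at_most_cover K _ [set y | adj x y /\ ~ special f y] x.
    by move=> y yI yP; apply: (deg x Nx y yI) => i; case: (yP i).
  by exists b => _; split=> // y xy Ny; apply: b2.
pose idx n : 'I_K := Ordinal (ltn_pmod n K_gt0).
(* The recursive calls go to [n %/ K], hence the fuel. *)
pose fix walk (fuel n : nat) {struct fuel} : S := match fuel with
  | 0 => c
  | k.+1 => match n with 0 => c | n'.+1 => nbr (walk k (n' %/ K)) (idx n') end
  end.
have walk_fuel a b n : n <= a -> n <= b -> walk a n = walk b n.
  elim: a b n => [|a IH] [|b] [|n] //= na nb.
  rewrite (IH b) //; exact: leq_trans (leq_div _ _) _.
pose e n := walk n n.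
have eS n : e n.+1 = nbr (e (n %/ K)) (idx n).
  rewrite /e /=; congr (nbr _ _); apply: walk_fuel => //; exact: leq_div.
have Ne n : ~ special f (e n).
  elim/ltn_ind: n => -[//|n] IH; rewrite eS.
  have Np : ~ special f (e (n %/ K)) by apply: IH; rewrite ltnS leq_div.
  by have [/(_ (idx n))[->//|[]]] := nbrP _ Np.
exists e; split=> // [n|r].
  rewrite eS.
  by have [/(_ (idx n))[->|[]]] := nbrP _ (Ne (n %/ K)); [left|right].
split=> // p _ y Ny py; have [_ /(_ _ py Ny)[i ->]] := nbrP _ (Ne p).
exists i => //; rewrite eS divnMDl // divn_small // addn0; congr (nbr _ _).
by apply: val_inj; rewrite /= modnMDl modn_small.
Qed.

End Charts.

(** * Components in elementary extensions *)

Lemma definable_adj C n (s t : term C n) :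
  definable (fun S c v => adj (eval c v s) (eval c v t)).
Proof. by apply: definable_or; apply: definable_edge. Qed.

Section ElementaryExtensions.
Variables (m K : nat).
Hypothesis K_gt0 : 0 < K.
Variables (M N : structure) (j : M -> N) (f : 'I_m -> M).
Hypothesis jE : elementary j.
Hypothesis deg : degree_le K f.

Lemma elementary_eq x y : j x = j y <-> x = y.
Proof.
have [H1 H2] := elementary_sat jE id (Eq (Var M ord0) (Cst 1 y)) (fun=> x).
by split; [apply: H2|apply: H1].
Qed.

Lemma elementary_edge x y : edge (j x) (j y) <-> edge x y.
Proof.
have [H1 H2] := elementary_sat jE id (Rel (Var M ord0) (Cst 1 y)) (fun=> x).
by split; [apply: H2|apply: H1].
Qed.

Lemma elementary_degree : degree_le K (j \o f).
Proof.
move=> x Nx y yI xy.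
pose P (S : structure) (c : M -> S) (v : 'I_K.+2 -> S) :=
  (forall a, v ord0 <> c (f a)) /\
  (forall i, adj (v ord0) (v (lift ord0 i))) /\
  (forall i k, i != k -> v (lift ord0 i) <> v (lift ord0 k)).
have dP : definable P.
  apply: definable_and.
    apply: definable_forall_fin => a; apply: definable_not.
    exact: (definable_eq (Var M ord0) (Cst _ (f a))).
  apply: definable_and.
    apply: definable_forall_fin => i.
    exact: (definable_adj (Var M ord0) (Var M (lift ord0 i))).
  apply: definable_forall_fin => i; apply: definable_forall_fin => k.
  apply: definable_imp (definable_const _ _ _) (definable_not _).
  exact: (definable_eq (Var M (lift ord0 i)) (Var M (lift ord0 k))).
have [|v [v1 [v2 v3]]] := elementary_definable jE dP.
  exists (extend x y); split=> [a|].
    by rewrite extend0 => E; apply: Nx; exists a.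
  split=> [i|i k ik]; first by rewrite extend0 extend_lift.
  by rewrite !extend_lift => /yI /eqP; apply/negP.
apply: (deg (x := v ord0) _ (y := fun i => v (lift ord0 i))) => //.
  by case=> a /v1.
by move=> i k E; apply: contrapT => /eqP/v3.
Qed.

(** The finitely many neighbours of [x] are listed by a formula with
    parameters, which leaves no room for a new neighbour. Thus an elementary
    extension only adds whole components. *)
Lemma elementary_closed x y : ~ special f x -> adj (j x) y ->
  exists z, y = j z /\ adj x z.
Proof.
move=> Nx xy.
have [b [_ bP]] := at_most_cover x (deg Nx).
suff [i yi] : exists i, y = j (b i).
  exists (b i); split=> //.
  by case: xy; rewrite yi => /elementary_edge; [left|right].
apply: contrapT => none.
pose P (S : structure) (c : M -> S) (v : 'I_1 -> S) :=
  adj (c x) (v ord0) /\ (forall i, v ord0 <> c (b i)).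
have dP : definable P.
  apply: definable_and; first exact: (definable_adj (Cst _ x) (Var M ord0)).
  apply: definable_forall_fin => i; apply: definable_not.
  exact: (definable_eq (Var M ord0) (Cst _ (b i))).
have [|v [/bP[i vi] /(_ i)]] := elementary_definable jE dP; last by [].
by exists (fun=> y); split=> // i yi; apply: none; exists i.
Qed.

(** The part of [e] up to [r] satisfies a formula which also says that it
    avoids the entries of [phi]; that formula is then satisfied in [M]. *)
Lemma elementary_approx e r n (phi : 'I_n -> M) :
  approx K (j \o f) (j \o f) r e e -> (forall s x, e s <> j x) ->
  exists h : nat -> M, approx K (j \o f) f r e h /\
    forall s, s <= r -> forall i, h s <> phi i.
Proof.
move=> [e1 e2 e3] Ne.
pose P (S : structure) (c : M -> S) (v : 'I_r.+1 -> S) :=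
  (forall s a, v s <> c (f a)) /\
  (forall s t : 'I_r.+1, (e s = e t <-> v s = v t) /\
     (edge (e s) (e t) <-> edge (v s) (v t)) /\
     (forall a, edge (e s) (j (f a)) <-> edge (v s) (c (f a))) /\
     (forall a, edge (j (f a)) (e s) <-> edge (c (f a)) (v s))) /\
  (forall p : 'I_r.+1, p.+1 * K <= r -> forall y, (forall a, y <> c (f a)) ->
     adj (v p) y ->
     exists t : 'I_r.+1, (exists2 q, q < K & t = (p * K + q).+1 :> nat) /\
       y = v t) /\
  (forall s i, v s <> c (phi i)).
have dP : definable P.
  apply: definable_and.
    apply: definable_forall_fin => s; apply: definable_forall_fin => a.
    exact: definable_not (definable_eq (Var M s) (Cst _ (f a))).
  apply: definable_and.
    apply: definable_forall_fin => s; apply: definable_forall_fin => t.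
    apply: definable_and.
      apply: definable_iff (definable_const _ _ _) _.
      exact: (definable_eq (Var M s) (Var M t)).
    apply: definable_and.
      apply: definable_iff (definable_const _ _ _) _.
      exact: (definable_edge (Var M s) (Var M t)).
    apply: definable_and; apply: definable_forall_fin => a;
      apply: definable_iff (definable_const _ _ _) _.
      exact: (definable_edge (Var M s) (Cst _ (f a))).
    exact: (definable_edge (Cst _ (f a)) (Var M s)).
  apply: definable_and.
    apply: definable_forall_fin => p.
    apply: definable_imp (definable_const _ _ _) _.
    apply: (definable_forall (P := fun S c y v => (forall a, y <> c (f a)) ->
     adj (v p) y -> exists t : 'I_r.+1,
     (exists2 q, q < K & t = (p * K + q).+1 :> nat) /\ y = v t)).
    apply: definable_imp.
      apply: definable_forall_fin => a.
      exact: definable_not (definable_eq (Var M ord0) (Cst _ (f a))).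
    apply: definable_imp.
      exact: (definable_adj (Var M (lift ord0 p)) (Var M ord0)).
    apply: definable_exists_fin => t.
    apply: definable_and (definable_const _ _ _) _.
    exact: (definable_eq (Var M ord0) (Var M (lift ord0 t))).
  apply: definable_forall_fin => s; apply: definable_forall_fin => i.
  exact: definable_not (definable_eq (Var M s) (Cst _ (phi i))).
have [|v [v1 [v2 [v3 v4]]]] := elementary_definable jE dP.
  exists (fun s => e s); split=> [s a E|].
    by apply: (e1 s (leq_ord s)); exists a.
  split=> [s t|]; first by have [] := e2 s t (leq_ord s) (leq_ord t).
  split=> [p pr y Ny py|s i]; last exact: Ne.
  have [|q qK yq] := e3 p pr y _ py; first by case=> a /Ny.
  have qr : (p * K + q).+1 < r.+1 by rewrite ltnS (leq_trans (child_le _ qK)).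
  by exists (Ordinal qr); split=> //; exists q.
have E s : s <= r -> (inord s : 'I_r.+1) = s :> nat by exact: inordK.
exists (fun s => v (inord s)); split; last by move=> s _ i; apply: v4.
split=> [s sr [a]|s t sr tr|p pr y Ny py]; first exact: v1.
  by have [a1 [a2 [a3 a4]]] := v2 (inord s) (inord t);
    move: a1 a2 a3 a4; rewrite !E.
have pr' : p <= r := leq_trans (parent_le K_gt0 p) pr.
have [|a ya|t [[q qK tq] yt]] := v3 (inord p) _ y _ py.
- by rewrite E.
- by apply: Ny; exists a.
exists q => //; rewrite yt; congr v; apply: ord_inj.
by rewrite tq E //= inordK // ltnS (leq_trans (child_le _ qK)).
Qed.

End ElementaryExtensions.

(** * A criterion for saturation *)

Section Saturation.
Variables (m K : nat).
Hypothesis K_gt0 : 0 < K.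
Variables (M : structure) (f : 'I_m -> M) (mu : Type).
Hypothesis deg : degree_le K f.
Hypothesis mu_inf : infinite_set [set: mu].

(** The combinatorial core of saturation: if every finite part of a component
    occurs in [M] outside every finite set, then the whole component occurs in
    [M] in [mu] pairwise disjoint copies. *)
Definition many_copies : Prop :=
  forall (N : structure) (f' : 'I_m -> N) (e : nat -> N), heap K e ->
  (forall r (l : set M), finite_set l ->
     exists h, approx K f' f r e h /\ forall s, s <= r -> ~ l (h s)) ->
  exists g : mu -> nat -> M, (forall i, copy K f' f e (g i)) /\
    forall i i' s t, g i s = g i' t -> i = i'.

Hypothesis copies : many_copies.

(** If [c] is not already in [M], then its whole component is new, so all
    finite parts of it occur in [M] infinitely often, and [M] contains [mu]
    disjoint copies of it. They cannot all meet [B], since choosing a common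
    point for each copy would embed [mu] into [B]. Exchanging the component
    with a copy that misses [B] is the required automorphism. *)
Lemma move_into (N : structure) (j : M -> N) (B : set M) (c : N) :
  elementary j -> ~ ([set: mu] #<= B) ->
  exists tau : N -> N, [/\ automorphism tau,
    forall b, B b -> tau (j b) = j b & exists w, tau c = j w].
Proof.
move=> jE muB.
case: (pselect (exists w, c = j w)) => [[w cw]|Nc].
  exists id; split=> //; last by exists w.
  by split=> //; exists id.
have Ncs : ~ special (j \o f) c by case=> a ca; apply: Nc; exists (f a).
have degN := elementary_degree jE deg.
have [e [e0 heap_e ee]] := exists_chart K_gt0 degN Ncs.
have Ne s x : e s <> j x.
  elim/ltn_ind: s x => -[_ x ex|s IH x ex].
    by apply: Nc; exists x; rewrite -e0.
  have Ps : s %/ K < s.+1 by rewrite ltnS leq_div.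
  case: (heap_e s) => [E|]; first by apply: (IH _ Ps x); rewrite -E.
  have Nx : ~ special f x.
    case=> a xa; have [/(_ s.+1 (leqnn _)) H _ _] := ee s.+1.
    by apply: H; exists a; rewrite ex xa.
  rewrite ex => /adjC/(elementary_closed jE deg Nx)[z [ez _]].
  exact: IH _ Ps z ez.
have [|g [gcopy gdisj]] := copies (f' := j \o f) heap_e.
  move=> r l /finite_setP_range[n [phi ->]].
  have [h [h1 h2]] := elementary_approx K_gt0 jE phi (ee r) Ne.
  by exists h; split=> // s sr [i _ /esym]; apply: h2.
have [i gB] : exists i, forall s, ~ B (g i s).
  apply: contrapT => none; apply: muB.
  have /choice[s sP] : forall i, exists s, B (g i s).
    move=> i; apply: contrapT => ni; apply: none; exists i => s Bs.
    by apply: ni; exists s.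
  apply: (card_le_inj (f := fun i => g i (s i))) => // i i' _ _; exact: gdisj.
have eg : copy K (j \o f) (j \o f) e (fun s => j (g i s)).
  move=> r; have [g1 g2 g3] := gcopy i r.
  split=> [s sr [a /(elementary_eq jE)]|s t sr tr|].
  - by move=> E; apply: (g1 s sr); exists a.
  - have [a1 a2 a3 a4] := g2 s t sr tr.
    by split=> *; rewrite ?(elementary_eq jE) ?(elementary_edge jE).
  - move=> p pr y Ny /(elementary_closed jE deg)[|z [yz pz]].
      by apply: g1; apply: leq_trans (parent_le K_gt0 p) pr.
    subst y; have [|q qK ->] := g3 p pr z _ pz; last by exists q.
    by case=> a za; apply: Ny; exists a; rewrite za.
have [|tau [tauA tauE tauO]] := swap_automorphism ee eg; first by [].
exists tau; split=> //; last by exists (g i 0); rewrite -e0.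
move=> b Bb; apply: tauO => s; first by move/esym; apply: Ne.
by move=> /(elementary_eq jE) E; apply: (gB s); rewrite -E.
Qed.

(** The coordinates are moved one at a time; the values already found are
    added to [B], to be fixed by the next automorphism. *)
Lemma move_tuple_into (N : structure) (j : M -> N) (B : set M) n
    (v : 'I_n -> N) :
  elementary j -> ~ ([set: mu] #<= B) ->
  exists tau : N -> N, [/\ automorphism tau,
    forall b, B b -> tau (j b) = j b & exists w, tau \o v = j \o w].
Proof.
move=> jE muB; elim: n v => [|n IH] v.
  exists id; split=> //; first by split=> //; exists id.
  by exists (@no_var M); apply: funext => -[].
have [tau1 [[b1 tau1E] tau1B [w tau1w]]] := IH (fun i => v (lift ord0 i)).
have [|tau2 [[b2 tau2E] tau2B [w0 tau2w]]] :=
    move_into (B := B `|` range w) (tau1 (v ord0)) jE.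
  by apply: not_card_le_setU => //; apply: finite_image; exact: finite_finset.
exists (tau2 \o tau1); split.
- by split=> [|x y]; [exact: bij_comp|rewrite /= tau2E tau1E].
- by move=> b Bb; rewrite /= tau1B // tau2B //; left.
exists (extend w0 w); apply: funext => i /=.
case: (unliftP ord0 i) => [k ->|->]; rewrite ?extend_lift ?extend0 //.
have /(congr1 (@^~ k)) /= -> := tau1w.
by rewrite tau2B //; right; exists k.
Qed.

(** A realization in an elementary extension is moved into [M] by an
    automorphism fixing [B], and there it still satisfies the type, because the
    extension is elementary. *)
Theorem saturated_of_many_copies : saturated M mu.
Proof.
move=> B [_ muB] n p [N [j [jE [v vp]]]].
have [tau [tauA tauB [w tauw]]] := move_tuple_into v jE muB.
exists w => phi /vp Nphi; apply/(elementary_sat jE); rewrite -tauw.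
have -> : j \o (fun b : B => val b) = tau \o (fun b : B => j (val b)).
  by apply: funext => b /=; rewrite tauB //; exact: set_valP.
exact/(sat_automorphism tauA).
Qed.

End Saturation.

(** * Limits along ultrafilters *)

Section UltraFilterFacts.
Variables (I : Type) (U : set_system I).
Hypothesis UU : UltraFilter U.

Lemma ultra_notP (A : set I) : ~ U A <-> U (~` A).
Proof.
split=> [NUA|UnA UA]; first by case: (in_ultra_setVsetC A UU).
by have [i []] := filter_ex (filterI UA UnA).
Qed.

Lemma ultra_or (A B : set I) : U (A `|` B) -> U A \/ U B.
Proof.
move=> UAB; case: (pselect (U A)) => [|/ultra_notP UnA]; first by left.
by right; apply: filterS (filterI UAB UnA) => i [[]].
Qed.

Lemma ultra_exists_fin (T : finType) (P : T -> set I) :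
  U [set i | exists t, P t i] -> exists t, U (P t).
Proof.
move=> UP; apply: contrapT => none.
have /filter_forall nP t : U (~` P t).
  by apply/ultra_notP => UPt; apply: none; exists t.
by have [i [[t Pti] /(_ t)]] := filter_ex (filterI UP nP).
Qed.

Lemma ultra_iff (Q : Prop) (P : set I) : (Q <-> U P) ->
  U [set i | Q <-> P i].
Proof.
move=> [QU UQ]; case: (pselect (U P)) => [UP|NUP]; last first.
  apply: filterS ((ultra_notP P).1 NUP) => i NPi.
  by split=> // /QU.
by apply: filterS (UP) => i Pi; split=> // _; apply: UQ.
Qed.

Lemma filter_leq r (P : nat -> set I) : (forall s, s <= r -> U (P s)) ->
  U [set i | forall s, s <= r -> P s i].
Proof.
move=> UP; have : U [set i | forall s : 'I_r.+1, P s i].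
  by apply: filter_forall => s; apply: UP; apply: leq_ord.
by apply: filterS => i iP s sr; apply: (iP (Ordinal (sr : s < r.+1))).
Qed.

End UltraFilterFacts.

(** The finitely many nodes used by earlier approximations are avoided by the
    next one. *)
Lemma disjoint_sequence m K (N A : structure) (f' : 'I_m -> N) (f : 'I_m -> A)
    (e : nat -> N) :
  (forall r (l : set A), finite_set l ->
     exists h, approx K f' f r e h /\ forall s, s <= r -> ~ l (h s)) ->
  exists H : nat -> nat -> A, (forall r, approx K f' f r e (H r)) /\
    forall r r' s t, s <= r -> t <= r' -> H r s = H r' t -> r = r'.
Proof.
move=> approximations.
have /choice[C CP] : forall rl : nat * set A, exists h, finite_set rl.2 ->
    approx K f' f rl.1 e h /\ forall s, s <= rl.1 -> ~ rl.2 (h s).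
  move=> [r l]; case: (pselect (finite_set l)) => [lfin|Nl].
    by have [h hP] := approximations r l lfin; exists h.
  by exists (fun=> (sval (cid (approximations 0 _ (finite_set0 _)))) 0).
pose fix used r : set A := match r with
  | 0 => set0
  | r'.+1 => used r' `|` [set C (r', used r') s | s in `I_r'.+1]
  end.
pose H r := C (r, used r).
have used_fin r : finite_set (used r).
  elim: r => [|r IH] //=; rewrite finite_setU; split=> //.
  by apply: finite_image; apply: finite_II.
have HP r := CP (r, used r) (used_fin r).
exists H; split=> [r|]; first by case: (HP r).
have used_lt r r' s : s <= r -> r < r' -> used r' (H r s).
  move=> sr; elim: r' => // r' IH; rewrite ltnS leq_eqVlt => /predU1P[<-|/IH ?].
    by right; exists s.
  by left.
move=> r r' s t sr tr E; case: (ltngtP r r') => // rr.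
  by case: (HP r') => _ /(_ t tr) []; rewrite -/(H r') -E; apply: used_lt.
by case: (HP r) => _ /(_ s sr) []; rewrite -/(H r) E; apply: used_lt.
Qed.

Section Limits.
Variables (m K : nat) (A M : structure) (emb : A -> M) (f : 'I_m -> A).
Hypothesis K_gt0 : 0 < K.
Variables (I : Type) (U : set_system I) (lim : (I -> A) -> M).

(** What ultrapowers and ultrafilter extensions have in common: elements arise
    as limits [lim G] of functions from an index set to [A] along an
    ultrafilter, and the easy half of the theorem of Los holds for atomic
    formulas. *)
Record limit_map : Prop := LimitMap {
  limit_ultra : UltraFilter U;
  limit_eq : forall G G', U [set i | G i = G' i] -> lim G = lim G';
  limit_edge : forall G G', U [set i | edge (G i) (G' i)] ->
    edge (lim G) (lim G');
  limit_const : forall b, lim (fun=> b) = emb b;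
  limit_const_eq : forall G b, lim G = emb b -> U [set i | G i = b];
  limit_const_edgel : forall G b, edge (lim G) (emb b) ->
    U [set i | edge (G i) b];
  limit_const_edger : forall G b, edge (emb b) (lim G) ->
    U [set i | edge b (G i)];
  limit_neighbor : forall G y, ~ special (emb \o f) (lim G) ->
    ~ special (emb \o f) y -> adj (lim G) y ->
    exists2 G', y = lim G' & U [set i | adj (G i) (G' i)] }.

(** The other half of the theorem of Los for a pair of functions. It is
    automatic in an ultrapower; in an ultrafilter extension it fails in
    general and requires functions that are well spread. *)
Definition faithful (G G' : I -> A) : Prop :=
  (lim G = lim G' -> U [set i | G i = G' i]) /\
  (edge (lim G) (lim G') -> U [set i | edge (G i) (G' i)]).

Hypothesis L : limit_map.
Let UU : UltraFilter U := limit_ultra L.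
#[local] Existing Instance UU.

Lemma limit_special G :
  special (emb \o f) (lim G) <-> U [set i | special f (G i)].
Proof.
split=> [[a /(limit_const_eq L)]|/(ultra_exists_fin UU)[a Ua]].
  by apply: filterS => i Gi; exists a.
by exists a; rewrite /= -(limit_const L); apply: (limit_eq L).
Qed.

Lemma limit_nonspecial G :
  ~ special (emb \o f) (lim G) <-> U [set i | ~ special f (G i)].
Proof. by rewrite limit_special (ultra_notP UU). Qed.

Lemma limit_adj G G' : U [set i | adj (G i) (G' i)] -> adj (lim G) (lim G').
Proof. by case/(ultra_or UU) => /(limit_edge L); [left|right]. Qed.

Lemma limit_same_atoms G G' : faithful G G' ->
  U [set i | same_atoms (emb \o f) f (lim G) (lim G') (G i) (G' i)].
Proof.
move=> [GG'eq GG'edge].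
have U1 := ultra_iff UU (conj GG'eq (@limit_eq L G G')).
have U2 := ultra_iff UU (conj GG'edge (@limit_edge L G G')).
have U3 : U [set i | forall a, edge (lim G) (emb (f a)) <-> edge (G i) (f a)].
  apply: filter_forall => a; apply: (ultra_iff UU).
  by split=> [/(limit_const_edgel L)//|/(limit_edge L)]; rewrite limit_const.
have U4 : U [set i | forall a, edge (emb (f a)) (lim G) <-> edge (f a) (G i)].
  apply: filter_forall => a; apply: (ultra_iff UU).
  by split=> [/(limit_const_edger L)//|/(limit_edge L)]; rewrite limit_const.
by apply: filterS (filterI (filterI U1 U2) (filterI U3 U4)) => i [[? ?] [? ?]].
Qed.

(** A limit of better and better approximations is a copy. Atomic facts pass
    to the limit by faithfulness. A neighbour of the limit is itself a limit of
    neighbours, which are children of the given node for almost all indices,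
    and one child serves for almost all of them. *)
Lemma approx_limit (N : structure) (f' : 'I_m -> N) (e : nat -> N)
    (H : nat -> I -> A) :
  (forall s t, faithful (H s) (H t)) ->
  (forall r, U [set i | approx K f' f r e (H ^~ i)]) ->
  copy K f' (emb \o f) e (fun s => lim (H s)).
Proof.
move=> Hfaithful UH r; split=> [s sr|s t sr tr|p pr y Ny py].
- apply/limit_nonspecial; apply: filterS (UH r) => i [h1 _ _]; exact: h1.
- have [i [[_ h2 _] [a1 a2 a3 a4]]] :=
    filter_ex (filterI (UH r) (limit_same_atoms (Hfaithful s t))).
  have [b1 b2 b3 b4] := h2 s t sr tr.
  split=> [||a|a].
  + exact: iff_trans b1 (iff_sym a1).
  + exact: iff_trans b2 (iff_sym a2).
  + exact: iff_trans (b3 a) (iff_sym (a3 a)).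
  + exact: iff_trans (b4 a) (iff_sym (a4 a)).
- have Np : ~ special (emb \o f) (lim (H p)).
    apply/limit_nonspecial; apply: filterS (UH p) => i [h1 _ _]; exact: h1.
  have [G yG UG] := limit_neighbor L Np Ny py; subst y.
  have {}Ny := (limit_nonspecial G).1 Ny.
  have : U [set i | exists q : 'I_K, G i = H (p * K + q).+1 i].
    apply: filterS (filterI (UH r) (filterI UG Ny)) => i [[_ _ h3] [pG NG]].
    by have [q qK Gi] := h3 p pr _ NG pG; exists (Ordinal qK).
  by case/(ultra_exists_fin UU) => q /(limit_eq L) ->; exists q.
Qed.

(** In the other direction, almost all indices give approximations of a tuple
    of limits. If the neighbours of [H p i] were not exhausted by its children
    for almost all [i], a function [G] choosing the exceptional neighbours
    would have as limit a neighbour of [h p] that is not a child. *)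
Lemma approx_of_limit r (h : nat -> M) (H : nat -> I -> A) :
  (forall s, s <= r -> h s = lim (H s)) ->
  (forall s t, s <= r -> t <= r -> faithful (H s) (H t)) ->
  (forall s t G, s <= r -> t <= r -> U [set i | adj (H s i) (G i)] ->
     U [set i | ~ special f (G i)] -> faithful G (H t)) ->
  approx K (emb \o f) (emb \o f) r h h ->
  U [set i | approx K (emb \o f) f r h (H ^~ i)].
Proof.
move=> hH HH GH [h1 h2 h3].
have U1 : U [set i | forall s, s <= r -> ~ special f (H s i)].
  apply: (filter_leq UU) => s sr; apply/limit_nonspecial.
  by rewrite -hH //; apply: h1.
have U2 : U [set i | forall s, s <= r -> forall t, t <= r ->
    same_atoms (emb \o f) f (h s) (h t) (H s i) (H t i)].
  apply: (filter_leq UU) => s sr; apply: (filter_leq UU) => t tr.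
  by rewrite !hH //; apply: limit_same_atoms; apply: HH.
have U3 : U [set i | forall p, p <= r -> p.+1 * K <= r -> forall y,
    ~ special f y -> adj (H p i) y ->
    exists2 q, q < K & y = H (p * K + q).+1 i].
  apply: (filter_leq UU) => p pr.
  apply: contrapT => /(ultra_notP UU) bad.
  have pKr : p.+1 * K <= r.
    have [i nbad] := filter_ex bad.
    by apply: contrapT => NpK; apply: nbad => /NpK.
  pose escapes i y := [/\ ~ special f y, adj (H p i) y &
    ~ exists2 q, q < K & y = H (p * K + q).+1 i].
  have Uescape : U [set i | exists y, escapes i y].
    apply: filterS bad => i nbad; apply: contrapT => none.
    apply: nbad => _ y Ny py; apply: contrapT => Nq.
    by apply: none; exists y.
  have /choice[G GP] : forall i, exists y, (exists y', escapes i y') ->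
      escapes i y.
    move=> i; case: (pselect (exists y', escapes i y')) => [[y Ey]|NE].
      by exists y.
    by exists (H p i) => /NE.
  have UG : U [set i | escapes i (G i)] by apply: filterS Uescape.
  have NG : U [set i | ~ special f (G i)] by apply: filterS UG => i [].
  have pG : U [set i | adj (H p i) (G i)] by apply: filterS UG => i [].
  have [] := h3 p pKr (lim G) ((limit_nonspecial G).2 NG).
    by rewrite hH //; apply: limit_adj.
  move=> q qK; have qr := leq_trans (child_le p qK) pKr.
  rewrite hH // => E.
  have UGq := (GH p _ G pr qr pG NG).1 E.
  have [i [[_ _ Nq] Gq]] := filter_ex (filterI UG UGq).
  by apply: Nq; exists q.
apply: filterS (filterI U1 (filterI U2 U3)) => i [i1 [i2 i3]].
split=> [//|s t sr tr|p pr]; first exact: i2.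
by apply: i3 => //; apply: leq_trans (parent_le K_gt0 p) pr.
Qed.

End Limits.

Lemma approx_self m K (S T : structure) (f : 'I_m -> S) (f' : 'I_m -> T) r e h :
  approx K f f' r e h -> approx K f' f' r h h.
Proof. by case. Qed.

Lemma limit_avoid m (A M : structure) (emb : A -> M) (f : 'I_m -> A) I
    (U : set_system I) (lim : (I -> A) -> M) (l : set A) G :
  limit_map emb f U lim -> finite_set l -> ~ (emb @` l) (lim G) ->
  U [set i | ~ l (G i)].
Proof.
move=> L /finite_setP_range[n [phi ->]] Nl; have UU := limit_ultra L.
apply/(ultra_notP UU) => Ul; apply: Nl.
have [|k /(limit_eq L) ->] :=
    ultra_exists_fin UU (P := fun k => [set i | G i = phi k]).
  by apply: filterS Ul => i [k _ ki]; exists k.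
by exists (phi k); [exists k|rewrite (limit_const L)].
Qed.

(** * Ultrapowers by regular ultrafilters *)

Section Ultrapower.
Variables (m K : nat) (A : structure) (f : 'I_m -> A).
Hypothesis K_gt0 : 0 < K.
Variables (I : Type) (D : set_system I).
Hypothesis DU : UltraFilter D.

Definition ultrapower_class (G : I -> A) : ultrapower A D :=
  exist _ (ultra_class D G) (ex_intro _ G erefl).

Definition ultrapower_diag (b : A) : ultrapower A D :=
  ultrapower_class (fun=> b).

Lemma ultrapower_class_eq G G' :
  ultrapower_class G = ultrapower_class G' <-> D [set i | G i = G' i].
Proof.
split=> [/(congr1 sval) /= E|DGG'].
  have : ultra_class D G' G' by apply: filterS filterT.
  by rewrite -E.
apply: eq_exist; apply/seteqP; split=> H /= DH.
  by apply: filterS (filterI DGG' DH) => i /= [<-].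
by apply: filterS (filterI DGG' DH) => i /= [->].
Qed.

Lemma ultrapower_class_edge G G' :
  edge (ultrapower_class G) (ultrapower_class G') <->
  D [set i | edge (G i) (G' i)].
Proof.
split=> [[g [g' [/= DG DG' De]]]|De]; last first.
  by exists G, G'; split=> //; apply: filterS filterT.
by apply: filterS (filterI (filterI DG DG') De) => i [[/= -> ->]].
Qed.

Lemma ultrapower_class_surj x : exists G, x = ultrapower_class G.
Proof. by case: x => c [G cG]; exists G; apply: eq_exist. Qed.

Lemma ultrapower_limit : limit_map ultrapower_diag f D ultrapower_class.
Proof.
split=> //.
- by move=> G G' /ultrapower_class_eq.
- by move=> G G' /ultrapower_class_edge.
- by move=> G b /ultrapower_class_eq.
- by move=> G b /ultrapower_class_edge.
- by move=> G b /ultrapower_class_edge.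
move=> G y _ _; have [G' ->] := ultrapower_class_surj y => GG'.
exists G' => //; case: GG' => /ultrapower_class_edge; apply: filterS => i;
  by [left|right].
Qed.

Lemma ultrapower_faithful G G' : faithful D ultrapower_class G G'.
Proof. by split=> [/ultrapower_class_eq|/ultrapower_class_edge]. Qed.

Lemma ultrapower_degree :
  degree_le K f -> degree_le K (ultrapower_diag \o f).
Proof.
move=> deg x; have [G ->] := ultrapower_class_surj x.
move=> /(limit_nonspecial ultrapower_limit) NG y yI ay.
have /choice[Y YP] : forall k, exists Y, y k = ultrapower_class Y.
  by move=> k; apply: ultrapower_class_surj.
have Dadj : D [set i | forall k, adj (G i) (Y k i)].
  apply: filter_forall => k; have := ay k; rewrite YP.
  by case=> /ultrapower_class_edge; apply: filterS => i; [left|right].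
have Dinj : D [set i | forall k k', k != k' -> Y k i <> Y k' i].
  apply: filter_forall => k; apply: filter_forall => k'.
  case: eqVneq => [_|kk']; first by apply: filterS filterT.
  have : D (~` [set i | Y k i = Y k' i]).
    apply/(ultra_notP DU) => /ultrapower_class_eq.
    by rewrite -!YP => /yI /eqP; rewrite (negbTE kk').
  by apply: filterS.
have [i [Ni [Ai Ii]]] := filter_ex (filterI NG (filterI Dadj Dinj)).
apply: (deg _ Ni (Y ^~ i)) => // k k' E.
by apply: contrapT => /eqP kk'; apply: (Ii _ _ kk').
Qed.

(** The sets [phi c] witness regularity, so each [i] lies in finitely many of
    them. Hence the trace of [S] on the set of those [c] is coded by a natural
    number, and [S] and [S'] have different traces at every [i] in [phi c] when
    [c] distinguishes them. Adding the size of the enumeration makes the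
    numbers tend to infinity along [D]. *)
Lemma regular_many_naturals (C : Type) :
  infinite_set [set: C] -> regular_ultrafilter C D ->
  exists rho : set C -> I -> nat,
    (forall S n, D [set i | n <= rho S i]) /\
    forall S S', S <> S' -> D [set i | rho S i <> rho S' i].
Proof.
move=> Cinf [_ _ [E [ED /card_eqPle[_ CE] Efin]]].
have [phi [phiET phiTI]] := card_le_exists_inj setT CE.
have phiD c : D (phi c) by apply: ED; apply: phiET.
have phiI : injective phi by move=> c c'; apply: phiTI.
have /choice[enum_i enum_iP] : forall i, exists np : {n & 'I_n -> C},
    [set c | phi c i] = range (projT2 np).
  move=> i; have [|n [psi E_psi]] := @finite_setP_range _ [set c | phi c i].
    apply: card_le_finite (Efin i).
    apply: (card_le_inj (f := phi)) => [c ci|c c' _ _ /phiI//].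
    by split=> //; apply: phiET.
  by exists (existT _ n psi).
pose n i := projT1 (enum_i i).
pose psi i : 'I_(n i) -> C := projT2 (enum_i i).
have psiP i c : phi c i -> exists x, c = psi i x.
  move=> ci; have : [set c | phi c i] c by [].
  by rewrite enum_iP => -[x _ <-]; exists x.
pose code S i : {ffun 'I_(n i) -> bool} := [ffun x => `[< S (psi i x) >]].
exists (fun S i => n i + pickle (code S i)); split=> [S k|S S' SS'].
  have /infiniteP Cge := Cinf; have /infinite_setN0[c0 _] := Cinf.
  have [iota [_ iotaTI]] := card_le_exists_inj c0 Cge.
  have : D [set i | forall x : 'I_k, phi (iota x) i].
    by apply: filter_forall => x; apply: phiD.
  apply: filterS => i ki; apply: leq_trans (leq_addr _ _).
  have /choice[y yP] : forall x : 'I_k, exists y, iota x = psi i y.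
    by move=> x; apply: psiP.
  have yI : injective y.
    move=> x x' xx'; apply: ord_inj; apply: iotaTI => //.
    by rewrite yP xx' -yP.
  by have := leq_card y yI; rewrite !card_ord.
have [c Sc] : exists c, ~ (S c <-> S' c).
  apply: contrapT => none; apply: SS'; apply/seteqP.
  by split=> c Sc; apply: contrapT => NSc; apply: none; exists c => -[H1 H2];
    apply: NSc; [apply: H1|apply: H2].
apply: filterS (phiD c) => i ci /addnI /(pcan_inj pickleK) /ffunP codeE.
have [x cx] := psiP i c ci.
apply: Sc; rewrite cx; have := codeE x; rewrite !ffunE => xE.
by split=> /asboolP Sx; apply/asboolP; [rewrite -xE|rewrite xE].
Qed.

(** The approximations [H r] in [A] are pairwise disjoint, so sequences of
    indices [r] that tend to infinity along [D] and differ almost everywhere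
    give disjoint copies in the ultrapower. *)
Lemma ultrapower_copies (C : Type) :
  infinite_set [set: C] -> regular_ultrafilter C D ->
  many_copies K (ultrapower_diag \o f) (set C).
Proof.
move=> Cinf Creg N f' e _ approximations.
have L := ultrapower_limit.
have [|H [HP Hdisj]] := @disjoint_sequence m K N A f' f e.
  move=> r l lfin.
  have [h [hP hl]] := approximations r _ (finite_image ultrapower_diag lfin).
  have /choice[G GP] : forall s, exists G, h s = ultrapower_class G.
    by move=> s; apply: ultrapower_class_surj.
  have Dapprox : D [set i | approx K (ultrapower_diag \o f) f r h (G ^~ i)].
    apply: (approx_of_limit K_gt0 L) (approx_self hP) => // *;
      exact: ultrapower_faithful.
  have Davoid : D [set i | forall s, s <= r -> ~ l (G s i)].
    apply: (filter_leq DU) => s sr; apply: (limit_avoid L) => //.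
    by rewrite -GP; apply: hl.
  have [i [ia il]] := filter_ex (filterI Dapprox Davoid).
  by exists (G ^~ i); split=> //; apply: approx_trans hP ia.
have [rho [rho_inf rho_neq]] := regular_many_naturals Cinf Creg.
exists (fun S s => ultrapower_class (fun i => H (rho S i) s)); split.
  move=> S; apply: (approx_limit L (H := fun s i => H (rho S i) s)).
    by move=> s t; apply: ultrapower_faithful.
  by move=> r; apply: filterS (rho_inf S r) => i ri; apply: approx_le ri (HP _).
move=> S S' s t /ultrapower_class_eq E; apply: contrapT => SS'.
have [i [[Ei Ni] [Si Ti]]] := filter_ex (filterI (filterI E (rho_neq _ _ SS'))
  (filterI (rho_inf S s) (rho_inf S' t))).
exact: Ni (Hdisj _ _ _ _ Si Ti Ei).
Qed.

End Ultrapower.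

(** * Many ultrafilters on the natural numbers *)

Lemma ultra_of_dichotomy (T : Type) (F : set_system T) :
  ProperFilter F -> (forall X, F X \/ F (~` X)) -> UltraFilter F.
Proof.
move=> FP dich; split=> // G GP FG; apply/seteqP; split=> // X GX.
case: (dich X) => // /FG GnX.
by have [i []] := filter_ex (filterI GX GnX).
Qed.

Definition prefix_bits (X : set nat) n : seq bool :=
  [seq `[< X k >] | k <- iota 0 n].

Lemma prefix_bits_inj X Y n :
  prefix_bits X n = prefix_bits Y n -> forall k, k < n -> (X k <-> Y k).
Proof.
move=> E k kn; have := congr1 (fun s => nth false s k) E.
rewrite /prefix_bits !(nth_map 0) ?size_iota // nth_iota // add0n => XY.
by split=> /asboolP H; apply/asboolP; [rewrite -XY|rewrite XY].
Qed.

(** Hausdorff's independent family: on the countable set of pairs (n, l),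
    where l is a finite list of bit strings, the set attached to [X] consists
    of the pairs for which l contains the first n bits of [X]. Pairs are coded
    by natural numbers. *)
Definition independent_set (X : set nat) : set nat :=
  [set r | match unpickle r : option (nat * seq (seq bool)) with
           | Some nl => prefix_bits X nl.1 \in nl.2
           | None => false
           end].

Lemma independent_family (T : finType) (c : T -> set nat)
    (S : set (set nat)) n : exists r, n <= r /\
  forall x, independent_set (c x) r <-> S (c x).
Proof.
have /choice[sep sepP] : forall xy : T * T, exists k,
    forall N, k < N -> prefix_bits (c xy.1) N = prefix_bits (c xy.2) N ->
    c xy.1 = c xy.2.
  move=> [x y] /=; case: (pselect (c x = c y)) => [|Nxy]; first by exists 0.
  have [k Nk] : exists k, ~ (c x k <-> c y k).
    apply: contrapT => none; apply: Nxy; apply/seteqP.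
    by split=> k ck; apply: contrapT => Nck; apply: none; exists k => -[H1 H2];
      apply: Nck; [apply: H1|apply: H2].
  by exists k => N kN bitsE; case: Nk; apply: (prefix_bits_inj bitsE).
(* From length [N0] on, the prefixes of distinct entries of [c] differ. *)
pose N0 := (\max_xy sep xy).+1.
have N0P N x y : N0 <= N -> prefix_bits (c x) N = prefix_bits (c y) N ->
    c x = c y.
  move=> N0N; apply: (sepP (x, y)); apply: leq_trans N0N.
  by rewrite ltnS; apply: (leq_bigmax (x, y)).
pose l N := [seq prefix_bits (c x) N | x <- enum T & `[< S (c x) >]].
have [j nj] := @injective_gtn (fun j => pickle (N0 + j, l (N0 + j)))
  (fun j j' E => @addnI N0 _ _ (congr1 fst (pcan_inj pickleK E))) n.
exists (pickle (N0 + j, l (N0 + j))); split; first exact: ltnW.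
move=> x; rewrite /independent_set /= pickleK /=.
split=> [/mapP[y]|Sx].
  rewrite mem_filter => /andP[/asboolP Sy _] /N0P -> //; exact: leq_addr.
by apply: map_f; rewrite mem_filter mem_enum andbT; apply/asboolP.
Qed.

(** Each [S] prescribes which of the independent sets belong to the
    ultrafilter. Independence makes the prescription consistent, also with the
    cofinite filter, and different prescriptions give different ultrafilters. *)
Lemma many_ultrafilters : exists w : set (set nat) -> set_system nat,
  [/\ forall S, UltraFilter (w S), forall S n, w S [set r | n <= r] &
      forall S S', S <> S' -> exists2 Y, w S Y & w S' (~` Y)].
Proof.
pose F (S : set (set nat)) : set_system nat := [set Y |
  exists (T : finType) (c : T -> set nat) n, forall r, n <= r ->
    (forall x, independent_set (c x) r <-> S (c x)) -> Y r].
have FP S : ProperFilter (F S).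
  apply: Build_ProperFilter_ex.
    move=> Y [T [c [n YP]]]; have [r [nr rP]] := independent_family c S n.
    by exists r; apply: YP.
  split.
  - by exists void, (fun=> set0), 0.
  - move=> Y Z [T [c [n YP]]] [T' [c' [n' ZP]]].
    exists (T + T')%type,
      (fun x => match x with inl y => c y | inr y => c' y end).
    exists (maxn n n') => r; rewrite geq_max => /andP[nr n'r] rP.
    by split; [apply: YP => // x; apply: (rP (inl x))|
               apply: ZP => // x; apply: (rP (inr x))].
  - move=> Y Z YZ [T [c [n YP]]]; exists T, c, n => r nr rP.
    by apply: YZ; apply: YP.
have /choice[w wP] S : exists G, UltraFilter G /\ F S `<=` G.
  exact: ultraFilterLemma.
have wU S : UltraFilter (w S) by case: (wP S).
have wE S X : w S [set r | independent_set X r <-> S X].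
  apply: (wP S).2; exists unit, (fun=> X), 0 => r _ /(_ tt); exact.
exists w; split=> [S|S n|S S' SS'].
- exact: wU.
- by apply: (wP S).2; exists void, (fun=> set0), n.
have wpos S1 X : S1 X -> w S1 (independent_set X).
  by move=> SX; apply: filterS (wE S1 X) => r [_]; apply.
have wneg S1 X : ~ S1 X -> w S1 (~` independent_set X).
  by move=> SX; apply: filterS (wE S1 X) => r [H _] /H.
have [X [[SX NS'X]|[NSX S'X]]] :
    exists X, (S X /\ ~ S' X) \/ (~ S X /\ S' X).
  apply: contrapT => none; apply: SS'; apply/seteqP.
  split=> X HX; apply: contrapT => NX; apply: none; exists X.
  - by left.
  - by right.
- by exists (independent_set X); [apply: wpos|apply: wneg].
- by exists (~` independent_set X); rewrite ?setCK; [apply: wneg|apply: wpos].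
Qed.

(** * Sparse sets in ultrafilters *)

Lemma maximal_independent (T : Type) (R : T -> T -> Prop) (V : set T) :
  (forall x y, R x y -> R y x) ->
  exists Z : set T, [/\ Z `<=` V,
    forall x y, Z x -> Z y -> x <> y -> ~ R x y &
    forall x, V x -> ~ Z x -> exists2 z, Z z & R x z].
Proof.
move=> Rsym.
pose P (Z : set T) := Z `<=` V /\ forall x y, Z x -> Z y -> x <> y -> ~ R x y.
have [|Z [[ZV Zind] Zmax]] := @Zorn_bigcup T P.
  move=> F FP Ftot; split=> [x [Z /FP[ZV _]]|]; first exact: ZV.
  move=> x y [Z FZ Zx] [Z' FZ' Zy].
  by case: (Ftot _ _ FZ FZ') => ZZ';
    [apply: (FP _ FZ').2|apply: (FP _ FZ).2] => //; apply: ZZ'.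
exists Z; split=> // x Vx NZx; apply: contrapT => none.
apply: (Zmax (Z `|` [set x])).
  by split=> [y|ZxZ]; [left|apply: NZx; apply: ZxZ; right].
have NR z : Z z -> ~ R x z by move=> Zz Rxz; apply: none; exists z.
split=> [y [/ZV//|->//]|y z [Zy|->] [Zz|->] // yz].
- exact: Zind.
- by move=> /Rsym; apply: NR.
- exact: NR.
Qed.

(** An ultrafilter contains an independent set of any graph of bounded degree,
    by induction on the bound: if a maximal independent set is not in the
    ultrafilter, then its complement is, and there the degrees are smaller,
    since every vertex outside the maximal set has a neighbour in it. *)
Lemma ultra_independent (T : Type) (u : set_system T) (R : T -> T -> Prop) :
  UltraFilter u -> (forall x y, R x y -> R y x) ->
  forall d (V : set T), u V ->
  (forall x, V x -> exists e : 'I_d -> T,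
     forall y, V y -> y <> x -> R x y -> exists i, y = e i) ->
  exists2 Z, u Z & forall x y, Z x -> Z y -> x <> y -> ~ R x y.
Proof.
move=> uU Rsym; elim=> [|d IH] V uV deg.
  exists V => // x y Vx Vy xy; have [e eP] := deg x Vx.
  by case/(eP y Vy); [apply: nesym|case].
have [Z [ZV Zind Zmax]] := maximal_independent V Rsym.
case: (pselect (u Z)) => [uZ|/(ultra_notP uU) uNZ]; first by exists Z.
apply: (IH (V `&` ~` Z)); first exact: filterI.
move=> x [Vx NZx]; have [e eP] := deg x Vx.
have [z Zz xz] := Zmax x Vx NZx.
have [|i zi] := eP z (ZV z Zz) _ xz; first by move=> E; apply: NZx; rewrite -E.
exists (fun k => e (lift i k)) => y [Vy NZy] yx xy.
have [k yk] := eP y Vy yx xy.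
case: (unliftP i k) => [k' kk'|ki]; first by exists k'; rewrite -kk'.
by case: NZy; rewrite yk ki -zi.
Qed.

Section BoundedDistance.
Variables (m K : nat) (A : structure) (f : 'I_m -> A).

(** Distance at most [n] in the graph that remains when the special nodes are
    removed. *)
Fixpoint near n (x y : A) : Prop :=
  match n with
  | 0 => x = y
  | n'.+1 => near n' x y \/
      exists2 z, near n' x z & [/\ adj z y, ~ special f z & ~ special f y]
  end.

Lemma near_trans a b x y z : near a x y -> near b y z -> near (a + b) x z.
Proof.
move=> xy; elim: b z => [|b IH] z /=; first by rewrite addn0 => <-.
rewrite addnS => -[/IH|[t /IH xt tz]]; first by left.
by right; exists t.
Qed.

Lemma near_step x y : adj x y -> ~ special f x -> ~ special f y -> near 1 x y.
Proof. by move=> *; right; exists x. Qed.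

Lemma near_sym a x y : near a x y -> near a y x.
Proof.
elim: a y => [|a IH] y /=; first by move->.
case=> [/IH|[z /IH zx [zy Nz Ny]]]; first by left.
by apply: (@near_trans 1 a y z x) => //; apply: near_step => //; apply: adjC.
Qed.

Lemma near_le a b x y : a <= b -> near a x y -> near b x y.
Proof.
by move=> /subnK <- xy; rewrite addnC; apply: near_trans xy _;
  elim: (b - a) => //= n; left.
Qed.

Lemma near_cover n : degree_le K f ->
  exists d, forall x, exists e : 'I_d -> A,
    forall y, near n x y -> exists i, y = e i.
Proof.
move=> deg.
have /choice[b bP] : forall x, exists b : 'I_K -> A, ~ special f x ->
    forall y, adj x y -> exists i, y = b i.
  move=> x; case: (pselect (special f x)) => [|Nx]; first by exists (fun=> x).
  by have [b [_ bP]] := at_most_cover x (deg x Nx); exists b.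
elim: n => [|n [d IH]].
  by exists 1 => x; exists (fun=> x) => y <-; exists ord0.
(* The points within distance [n], and the neighbours of each of them. *)
pose T := ('I_d + 'I_d * 'I_K)%type; exists #|{: T}| => x.
have [e eP] := IH x.
pose F (t : T) := match t with inl i => e i | inr ik => b (e ik.1) ik.2 end.
exists (fun i => F (enum_val i)) => y /= [/eP[i ->]|[z /eP[i ->] [zy Nz _]]].
  by exists (enum_rank (inl i : T)); rewrite enum_rankK.
have [k ->] := bP _ Nz y zy.
by exists (enum_rank (inr (i, k) : T)); rewrite enum_rankK.
Qed.

Lemma ultra_sparse (u : set_system A) n : UltraFilter u -> degree_le K f ->
  exists2 Z, u Z & forall x y, Z x -> Z y -> near n x y -> x = y.
Proof.
move=> uU deg; have [d dP] := near_cover n deg.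
have [||Z uZ Zind] := @ultra_independent _ u (near n) uU (@near_sym n) d setT.
- exact: filterT.
- by move=> x _; have [e eP] := dP x; exists e => y _ _; apply: eP.
exists Z => // x y Zx Zy xy; apply: contrapT => Nxy.
exact: (Zind x y).
Qed.

End BoundedDistance.

(** * Ultrafilter extensions *)

Section UltrafilterExtension.
Variables (m K : nat) (A : structure) (f : 'I_m -> A).
Hypothesis K_gt0 : 0 < K.
Local Notation ue := (ultrafilter_extension A).

Lemma uf_ultra (u : ue) : UltraFilter (sval u).
Proof. exact: (svalP u). Qed.
#[local] Existing Instance uf_ultra.

Lemma uf_eq (u v : ue) : (forall X, sval u X -> sval v X) -> u = v.
Proof.
case: u v => [u uU] [v vU] /= uv; apply: eq_exist; apply/esym.
by apply: max_filter uv.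
Qed.

Lemma uf_separate (u v : ue) : u <> v -> exists2 X, sval u X & sval v (~` X).
Proof.
move=> uv; apply: contrapT => none; apply: uv; apply: uf_eq => X uX.
apply: contrapT => /(ultra_notP (uf_ultra v)) vX.
by apply: none; exists X.
Qed.

Lemma ue_edge_image (u v : ue) : edge u v <->
  forall X, sval u X -> sval v (rel_image X).
Proof.
split=> [uv X uX|uv _ [X uX <-]]; last exact: uv.
by apply: uv; exists X.
Qed.

Lemma ue_edge_preimage (u v : ue) X : edge u v -> sval v X ->
  sval u [set w | exists2 s, X s & edge w s].
Proof.
move=> /ue_edge_image uv vX; apply: contrapT => /(ultra_notP (uf_ultra u)) nu.
have [s [Xs [w Nw ws]]] := filter_ex (filterI vX (uv _ nu)).
by apply: Nw; exists s.
Qed.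

Lemma ue_adj_preimage (u v : ue) X : adj u v -> sval v X ->
  sval u [set w | exists2 s, X s & adj w s].
Proof.
case=> [uv vX|/ue_edge_image vu /vu].
  apply: filterS (ue_edge_preimage uv vX) => w [s Xs ws].
  by exists s => //; left.
by apply: filterS => w [s Xs sw]; exists s => //; right.
Qed.

Definition uf_principal (b : A) : ue :=
  exist _ (principal_filter b) (principal_filter_ultra b).

Lemma uf_principalP (u : ue) b : u = uf_principal b <-> sval u [set b].
Proof.
split=> [->|ub]; first exact/principal_filterP.
by apply/esym/uf_eq => X /principal_filterP Xb; apply: filterS ub => _ ->.
Qed.

Lemma uf_nonspecial (u : ue) : ~ special (uf_principal \o f) u ->
  sval u [set w | ~ special f w].
Proof.
move=> Nu; have : sval u [set w | forall a, w <> f a].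
  apply: filter_forall => a; apply/(ultra_notP (uf_ultra u)) => ua.
  by apply: Nu; exists a; apply/uf_principalP.
by apply: filterS => w wf [a]; apply: wf.
Qed.

(** Distinct neighbours of [u] are separated by disjoint sets; almost all
    nodes [w] in the sense of [u] have a neighbour in each of these sets, hence
    as many neighbours as [u]. *)
Lemma ue_degree : degree_le K f -> degree_le K (uf_principal \o f).
Proof.
move=> deg u Nu y yI uy.
have /choice[X XP] : forall kk : 'I_K.+1 * 'I_K.+1, exists X, kk.1 != kk.2 ->
    sval (y kk.1) X /\ sval (y kk.2) (~` X).
  move=> [k k'] /=; case: eqVneq => [_|kk']; first by exists setT.
  have [|X yX yNX] := @uf_separate (y k) (y k'); last by exists X.
  by move=> /yI /eqP; apply/negP.
pose V k := [set w | forall k', k != k' -> X (k, k') w /\ ~ X (k', k) w].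
have yV k : sval (y k) (V k).
  apply: filter_forall => k'.
  case: eqVneq => [_|kk']; first by apply: filterS filterT.
  have [yX _] := XP (k, k') kk'.
  have [|_ yNX] := XP (k', k); first by rewrite /= eq_sym.
  by apply: filterS (filterI yX yNX) => w [].
have uV : sval u [set w | forall k, exists2 s, V k s & adj w s].
  by apply: filter_forall => k; apply: ue_adj_preimage (uy k) (yV k).
have [w [Nw wV]] := filter_ex (filterI (uf_nonspecial Nu) uV).
have /choice[s sP] : forall k, exists s, V k s /\ adj w s.
  by move=> k; have [s Vs ws] := wV k; exists s.
apply: (deg w Nw s) => [k k' E|k]; last by case: (sP k).
apply: contrapT => /eqP kk'.
have [_ NX] := (sP k).1 k' kk'.
by apply: NX; rewrite E; have [|//] := (sP k').1 k; rewrite eq_sym.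
Qed.

Section Push.
Variables (I : Type) (U : set_system I).
Hypothesis UU : UltraFilter U.

Lemma push_ultra (G : I -> A) : UltraFilter [set X | U (G @^-1` X)].
Proof.
by apply: ultra_of_dichotomy => X; apply: (in_ultra_setVsetC (G @^-1` X)).
Qed.

Definition push (G : I -> A) : ue := exist _ _ (push_ultra G).

Lemma push_edge G G' : U [set i | edge (G i) (G' i)] ->
  edge (push G) (push G').
Proof.
move=> UGG'; apply/ue_edge_image => X /= UX.
by apply: filterS (filterI UGG' UX) => i [GG' Xi]; exists (G i).
Qed.

(** The node [push G] has finitely many neighbours, so some set [V] belongs to
    [y] and to no other of them. Choosing neighbours of [G i] inside [V] gives
    a function whose push-forward is a neighbour containing [V], which can only
    be [y]. *)
Lemma push_neighbor G y : degree_le K f ->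
  ~ special (uf_principal \o f) (push G) -> adj (push G) y ->
  exists2 G', y = push G' & U [set i | adj (G i) (G' i)].
Proof.
move=> deg NG Gy.
have [nu [_ nuP]] := at_most_cover (push G) (ue_degree deg NG).
have /choice[X XP] : forall q, exists X, sval y X /\
    (nu q <> y -> ~ sval (nu q) X).
  move=> q; case: (pselect (nu q = y)) => [->|Nq].
    by exists setT; split=> //; apply: filterT.
  have [|X yX nX] := @uf_separate y (nu q); first exact: nesym.
  by exists X; split=> // _; apply/(ultra_notP (uf_ultra _)).
pose V := [set w | forall q, X q w].
have yV : sval y V by apply: filter_forall => q; case: (XP q).
suff [G' G'V GG'] : exists2 G', U [set i | V (G' i)] &
    U [set i | edge (G i) (G' i)] \/ U [set i | edge (G' i) (G i)].
  have UGG' : U [set i | adj (G i) (G' i)].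
    by case: GG'; apply: filterS => i; [left|right].
  exists G' => //.
  have [|q qE] := nuP (push G').
    by case: GG' => /push_edge; [left|right].
  rewrite qE; apply: contrapT => /nesym/(XP q).2; apply.
  by rewrite -qE; apply: filterS G'V => i; apply.
have pick (R : A -> A -> Prop) : U [set i | exists2 s, V s & R (G i) s] ->
    exists2 G', U [set i | V (G' i)] & U [set i | R (G i) (G' i)].
  move=> UR.
  have /choice[G' G'P] : forall i, exists s, (exists2 s', V s' & R (G i) s') ->
      V s /\ R (G i) s.
    move=> i; case: (pselect (exists2 s, V s & R (G i) s)) => [[s Vs Gs]|Ns].
      by exists s.
    by exists (G i) => /Ns.
  by exists G'; apply: filterS UR => i /G'P[].
case: Gy => [Gy|/ue_edge_image yG].
  have [G' VG' GG'] := pick _ (ue_edge_preimage Gy yV).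
  by exists G' => //; left.
have [G' VG' GG'] := pick (fun w s => edge s w) (yG _ yV).
by exists G' => //; right.
Qed.

Lemma push_limit : degree_le K f -> limit_map uf_principal f U push.
Proof.
move=> deg; split=> //.
- move=> G G' UGG'; apply: uf_eq => X /= UX.
  by apply: filterS (filterI UGG' UX) => i [/= <-].
- exact: push_edge.
- by move=> b; apply/uf_principalP => /=; apply: filterS filterT.
- by move=> G b /uf_principalP.
- move=> G b Gb.
  have /= := @ue_edge_preimage _ _ [set b] Gb ((uf_principalP _ _).1 erefl).
  by apply: filterS => i [_ ->].
- move=> G b /ue_edge_image /(_ [set b] ((uf_principalP _ _).1 erefl)) /=.
  by apply: filterS => i [_ ->].
by move=> G y NG _; apply: push_neighbor.
Qed.

(** On [Z] an equality or an edge between a value of [G] and a value of [G']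
    can only occur at equal indices. If it fails at almost all indices, then
    the image under [G] of the part of [Z] where it fails is a set that
    separates the push-forwards. *)
Lemma push_faithful (Z : set I) G G' : U Z ->
  (forall i i', Z i -> Z i' -> G i = G' i' -> i = i') ->
  (forall i i', Z i -> Z i' -> edge (G i) (G' i') -> i = i') ->
  faithful U push G G'.
Proof.
move=> UZ Zeq Zedge; split=> H; apply: contrapT => /(ultra_notP UU) UW;
  set W := (~` _) in UW; pose X := G @` (Z `&` W);
  have GX : sval (push G) X
    by (rewrite /=; apply: filterS (filterI UZ UW) => i ?; exists i).
- have G'X : U (G' @^-1` X) by move: GX; rewrite H.
  have [i' [[i [Zi Wi] ii'] [Zi' Wi']]] :=
    filter_ex (filterI G'X (filterI UZ UW)).
  by apply: Wi; rewrite /= {2}(Zeq _ _ Zi Zi' ii').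
- have G'X : U (G' @^-1` rel_image X) := (ue_edge_image _ _).1 H _ GX.
  have [i' [[_ [i [Zi Wi] <-] ii'] [Zi' Wi']]] :=
    filter_ex (filterI G'X (filterI UZ UW)).
  by apply: Wi; rewrite /= {2}(Zedge _ _ Zi Zi' ii').
Qed.

End Push.
Hypothesis deg : degree_le K f.

Lemma near_faithful (u : ue) (Z : set A) a b (G G' : A -> A) :
  sval u Z -> (forall x y, Z x -> Z y -> near f (a + b).+1 x y -> x = y) ->
  sval u [set x | near f a x (G x)] -> sval u [set x | near f b x (G' x)] ->
  sval u [set x | ~ special f (G x)] -> sval u [set x | ~ special f (G' x)] ->
  faithful (sval u) (push (uf_ultra u)) G G'.
Proof.
move=> uZ Zsparse nG nG' NG NG'.
apply: (@push_faithful _ _ _ (Z `&` ([set x | near f a x (G x)] `&`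
  [set x | near f b x (G' x)] `&` ([set x | ~ special f (G x)] `&`
  [set x | ~ special f (G' x)])))).
- exact: filterI uZ (filterI (filterI nG nG') (filterI NG NG')).
- move=> x y [Zx [[nx _] _]] [Zy [[_ ny] _]] E; apply: Zsparse => //; left.
  by apply: near_trans nx _; rewrite E; apply: near_sym.
- move=> x y [Zx [[nx _] [Nx _]]] [Zy [[_ ny] [_ Ny]]] xy.
  apply: Zsparse => //; rewrite -addSn; apply: near_trans (near_sym ny).
  by rewrite -addn1; apply: near_trans nx (near_step (or_introl xy) Nx Ny).
Qed.

(** The ultrafilter [u = h 0] is the limit of the identity along itself.
    Following edges from there, [h s] is a limit along [u] of a function that
    moves every node by distance at most [s]. Such functions are faithful,
    since [u] contains a set whose distinct points are far apart. *)
Lemma ue_approx_descends (N : structure) (f' : 'I_m -> N) e r (l : set A) h :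
  heap K e -> finite_set l -> approx K f' (uf_principal \o f) r e h ->
  (forall s, s <= r -> ~ (uf_principal @` l) (h s)) ->
  exists h', approx K f' f r e h' /\ forall s, s <= r -> ~ l (h' s).
Proof.
move=> heap_e lfin hP hl; set u := h 0.
have L := push_limit (uf_ultra u) deg.
have [h1 h2 _] := hP.
have nonspec s G : s <= r -> h s = push (uf_ultra u) G ->
    sval u [set x | ~ special f (G x)].
  by move=> sr hG; apply/(limit_nonspecial L); rewrite -hG; apply: h1.
have nearG s : s <= r -> exists G, h s = push (uf_ultra u) G /\
    sval u [set x | near f s x (G x)].
  elim/ltn_ind: s => -[_ _|s IH sr].
    exists id; split; first by apply: uf_eq.
    exact: filterS filterT.
  have ps : s %/ K <= s by apply: leq_div.
  have pr : s %/ K <= r by apply: leq_trans ps (ltnW sr).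
  have [G [hG nG]] := IH _ (ps : _ < s.+1) pr.
  have {}nG : sval u [set x | near f s x (G x)].
    by apply: filterS nG => x; apply: near_le.
  have [a1 a2 _ _] := h2 _ _ pr sr; have [_ a3 _ _] := h2 _ _ sr pr.
  case: (heap_e s) => [E|ea].
    exists G; split; first by rewrite -hG; apply/esym/a1.
    by apply: filterS nG => x; left.
  have ha : adj (push (uf_ultra u) G) (h s.+1).
    by rewrite -hG; case: ea => [/a2|/a3]; [left|right].
  have [||G' hG' GG'] := limit_neighbor L _ _ ha.
  - by rewrite -hG; apply: h1.
  - exact: h1.
  exists G'; split=> //.
  have NG := nonspec _ _ pr hG; have NG' := nonspec _ _ sr hG'.
  apply: filterS (filterI (filterI nG GG') (filterI NG NG')).
  by move=> x [[nx ax] [Nx Nx']]; right; exists (G x).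
have /choice[H HP] : forall s, exists G, s <= r ->
    h s = push (uf_ultra u) G /\ sval u [set x | near f s x (G x)].
  move=> s; case: (leqP s r) => [/nearG[G GP]|_]; first by exists G.
  by exists id.
have hH s sr := (HP s sr).1.
have nH s : s <= r -> sval u [set x | near f r.+1 x (H s x)].
  move=> sr; apply: filterS (HP s sr).2 => x; apply: near_le.
  exact: leq_trans sr (leqnSn r).
(* Room for two functions of displacement at most r + 1, one more than for
   the [H s], as neighbours of the [H s] are treated too, and for an edge. *)
have [Z uZ Zsparse] := ultra_sparse (r.+1 + r.+1).+1 (uf_ultra u) deg.
have happrox : sval u [set x | approx K (uf_principal \o f) f r h (H ^~ x)].
  apply: (approx_of_limit K_gt0 L) (approx_self hP) => //.
    move=> s t sr tr; apply: near_faithful uZ Zsparse _ _ _ _;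
      by [apply: nH|apply: nonspec (hH _ _)].
  move=> s t G sr tr sG NG.
  have NH := nonspec _ _ sr (hH s sr).
  apply: near_faithful uZ Zsparse _ _ _ _ => //;
    try by [apply: nH|apply: nonspec (hH _ _)].
  apply: filterS (filterI (filterI (HP s sr).2 sG) (filterI NH NG)).
  move=> x [[nx ax] [Nx Gx]]; apply: (@near_le _ _ _ s.+1) => //.
  by right; exists (H s x).
have Havoid : sval u [set x | forall s, s <= r -> ~ l (H s x)].
  apply: (filter_leq (uf_ultra u)) => s sr; apply: (limit_avoid L) => //.
  by rewrite -hH //; apply: hl.
have [x [xa xl]] := filter_ex (filterI happrox Havoid).
by exists (H ^~ x); split=> //; apply: approx_trans hP xa.
Qed.

(** The approximations [H r] in [A] are pairwise disjoint and, up to the last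
    level, not linked to each other. So the functions that send [r] to
    [H r s] are faithful along every ultrafilter on the natural numbers that
    contains the final segments, and different ultrafilters give disjoint
    copies. *)
Lemma ue_copies : many_copies K (uf_principal \o f) (set (set nat)).
Proof.
move=> N f' e heap_e approximations.
have [|H [HP Hdisj]] := @disjoint_sequence m K N A f' f e.
  move=> r l lfin.
  have [h [hP hl]] := approximations r _ (finite_image uf_principal lfin).
  exact: ue_approx_descends hP hl.
have [w [wU wtail wsep]] := many_ultrafilters.
exists (fun S s => push (wU S) (H ^~ s)); split=> [S|S S' s t E].
  apply: (approx_limit (push_limit (wU S) deg) (H := fun s i => H i s)).
    (* From index [s.+1 * K] on, all neighbours of [H r s] are in [H r]. *)
    move=> s t; apply: (push_faithful (wU S) (wtail S (maxn (s.+1 * K) t))).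
      move=> i i' /=; rewrite !geq_max => /andP[si _] /andP[_ ti'].
      by apply: Hdisj => //; apply: leq_trans (parent_le K_gt0 s) si.
    move=> i i' /=; rewrite !geq_max => /andP[si _] /andP[_ ti'] Hii'.
    have [_ _ Hcover] := HP i; have [Hns _ _] := HP i'.
    have [q qK Hq] := Hcover s si _ (Hns t ti') (or_introl Hii').
    by apply/esym; apply: Hdisj Hq => //; apply: leq_trans (child_le s qK) si.
  by move=> r; apply: filterS (wtail S r) => i ri; apply: approx_le ri (HP i).
apply: contrapT => /wsep[Y SY S'Y].
have pY : sval (push (wU S) (H ^~ s)) ((H ^~ s) @` (Y `&` [set r | s <= r])).
  by rewrite /=; apply: filterS (filterI SY (wtail S s)) => i ?; exists i.
have {}pY : w S' ((H ^~ t) @^-1` ((H ^~ s) @` (Y `&` [set r | s <= r]))).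
  by move: pY; rewrite E.
have [r' [[r [Yr sr] rr'] [NYr' tr']]] :=
  filter_ex (filterI pY (filterI S'Y (wtail S' t))).
by apply: NYr'; rewrite -(Hdisj _ _ _ _ sr tr' rr').
Qed.

End UltrafilterExtension.

(** * Saturation of the two extensions *)

Lemma almost_bounded_degree (A : structure) : almost_bounded A ->
  exists m (f : 'I_m -> A) K, 0 < K /\ degree_le K f.
Proof.
case=> /finite_setP_range[m [f fP]] [k kP].
(* A neighbour is a successor or a predecessor; the extra 1 makes the bound
   positive. *)
exists m, f, (k + k).+1; split=> // x Nx y yI xy.
have [|succ_k pred_k] := kP x.
  move=> x_inf; have : [set a | infinite_degree a] x by [].
  by rewrite fP => -[a _ ax]; apply: Nx; exists a.
have [g [gk gI]] := card_le_exists_inj 0 succ_k.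
have [g' [g'k g'I]] := card_le_exists_inj 0 pred_k.
have /choice[c cP] : forall i, exists z : 'I_k + 'I_k, match z with
    | inl a => edge x (y i) /\ g (y i) = a
    | inr a => edge (y i) x /\ g' (y i) = a end.
  move=> i; case: (xy i) => [e|e].
    by exists (inl (Ordinal (gk _ e : g (y i) < k))).
  by exists (inr (Ordinal (g'k _ e : g' (y i) < k))).
have cI : injective c.
  move=> i i' cc; apply: yI; have := cP i; have := cP i'; rewrite -cc.
  case: (c i) => a [e' ga'] [e ga]; [apply: gI|apply: g'I] => //;
    by rewrite ga ga'.
by have := leq_card c cI; rewrite card_sum !card_ord ltnNge leqW.
Qed.

Lemma infinite_powerset (T : Type) :
  infinite_set [set: T] -> infinite_set [set: set T].
Proof.
apply: contra_not; apply: card_le_finite.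
apply: (card_le_inj (f := set1)) => // x y _ _ E.
by have : [set y] x by rewrite -E.
Qed.

Theorem theorem2p21 (A : structure) (K I : Type) (D : set_system I) :
  almost_bounded A ->
  infinite_set [set: K] ->
  regular_ultrafilter K D ->
  saturated (ultrafilter_extension A) (set (set nat)) /\
  saturated (ultrapower A D) (set K).
Proof.
move=> /almost_bounded_degree[m [f [k [k_gt0 deg]]]] Kinf Dreg; split.
  apply: (saturated_of_many_copies k_gt0 (ue_degree deg)).
    by do 2!apply: infinite_powerset; apply: infinite_nat.
  exact: ue_copies.
have [_ DU _] := Dreg.
apply: (saturated_of_many_copies k_gt0 (ultrapower_degree DU deg)).
  exact: infinite_powerset.
exact: ultrapower_copies.
Qed.
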